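(* Let $d$ be a semi-metric of negative type, let $0<\rho_0<\rho^*<\rho_1<1$ and $\alpha\in(0,1)$. Suppose the single change-point alternative $H_A$ holds: $y_1,\dots,y_n$ are independent, $y_1,\dots,y_{\tau^*}\sim F_0$ and $y_{\tau^*+1},\dots,y_n\sim F_1$ with $\tau^*=\lceil n\rho^*\rceil$ and $F_0\ne F_1$ ($F_0$ fixed, while $F_1$ may depend on $n$). Suppose there is a constant $M>0$ such that $\widetilde k(y_i,y_i)\le M^2$ almost surely for all $i\in\{1,\dots,n\}$. (a) If $\sqrt n\,\|\mu_0-\mu_1\|_{\mathcal H}\to\infty$, then $\mathbb P_{H_A}\left(S_1>q_\alpha^{(1)}\right)\to1$ as $n\to\infty$, where $q^{(1)}_\alpha$ is the upper $\alpha$-th quantile of the asymptotic null distribution of $S_1$, i.e. of $$\max_{\rho_0\le\rho\le\rho_1}\frac{\sum_{l=1}^\infty\lambda_l\left(W_l^0(\rho)^2-\rho(1-\rho)\right)}{\rho(1-\rho)}$$ with $W_l^0$ independent Brownian bridges. (b) If $\mu_0=\mu_1$ and $\sqrt n\,|v_0-v_1|\to\infty$, then $\mathbb P_{H_A}\left(S_2>q_\alpha^{(2)}\right)\to1$ as $n\to\infty$, where $q^{(2)}_\alpha$ is the upper $\alpha$-th quantile of the asymptotic null distribution of $S_2$, i.e. of $\max_{\rho_0\le\rho\le\rho_1}|W^0(\rho)|/\sqrt{\rho(1-\rho)}$ with $W^0$ a Brownian bridge.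
   Context: Observations $y_1,\dots,y_n$ take values in a measurable space $\mathcal X$. A (measurable) function $d:\mathcal X\times\mathcal X\to\mathbb R$ is a semi-metric of negative type if (1) $d(y,y')=0$ iff $y=y'$; (2) $d(y,y')=d(y',y)$; (3) $\sum_{i,j=1}^m c_ic_jd(x_i,x_j)\le 0$ for all $m\ge2$, $x_1,\dots,x_m\in\mathcal X$, and $c_1,\dots,c_m\in\mathbb R$ with $\sum_ic_i=0$. Centered kernel: for any $y_0\in\mathcal X$ put $k^{(y_0)}(y,y')=\frac12[d(y,y_0)+d(y',y_0)-d(y,y')]$ and, with $Y,Y'\sim F_0$ independent, $\widetilde k(y,y')=k^{(y_0)}(y,y')-\mathbb E k^{(y_0)}(y,Y)-\mathbb E k^{(y_0)}(Y,y')+\mathbb E k^{(y_0)}(Y,Y')$ (this does not depend on $y_0$). The eigen-expansion with respect to $F_0$ is $\widetilde k(y,y')=\sum_{l\ge1}\lambda_l\psi_l(y)\psi_l(y')$, where $\int\widetilde k(y,y')\psi_l(y)\,dF_0(y)=\lambda_l\psi_l(y')$ and $\int\psi_l\psi_{l'}\,dF_0=\delta_{l,l'}$. The feature map is $\phi(y)=(\lambda_1^{1/2}\psi_1(y),\lambda_2^{1/2}\psi_2(y),\dots)^\top\in\mathcal H$, where $\mathcal H$ is a Hilbert (sequence) space with $\langle\phi(y),\phi(y')\rangle_{\mathcal H}=\sum_l\phi_l(y)\phi_l(y')=\widetilde k(y,y')$. For $j=0,1$: $\mu_j=\mathbb E_{Y\sim F_j}\phi(Y)$ and $v_j=\mathbb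 E_{Y\sim F_j}\|\phi(Y)-\mu_j\|_{\mathcal H}^2$. Statistics: for $1<t<n-1$ let $\bar d_{A(t)}=\frac1{t(n-t)}\sum_{i\le t<j}d(y_i,y_j)$, $\bar d_{B_1(t)}=\frac1{t(t-1)}\sum_{i\ne j;\,i,j\le t}d(y_i,y_j)$, $\bar d_{B_2(t)}=\frac1{(n-t)(n-t-1)}\sum_{i\neq j;\,i,j>t}d(y_i,y_j)$, $T_1(t)=\bar d_{A(t)}-\frac12\bar d_{B_1(t)}-\frac12\bar d_{B_2(t)}$ and $T_2(t)=|\bar d_{B_1(t)}-\bar d_{B_2(t)}|$. With $n_0=\lceil n\rho_0\rceil$, $n_1=\lceil n\rho_1\rceil$, $$S_1=\max_{n_0\le t\le n_1}\frac{t(n-t)}nT_1(t),\qquad S_2=\max_{n_0\le t\le n_1}\frac1{2\widehat s_n}\sqrt{\frac{t(n-t)}n}\,T_2(t),$$ where $\widehat s_n\ge0$, $\widehat s_n^2=\frac1n\sum_{i=1}^n(\bar d_i)^2-(\bar d)^2$, $\bar d_i=\frac1n\sum_{j=1}^nd(y_i,y_j)$, $\bar d=\frac1{n^2}\sum_{i,j=1}^nd(y_i,y_j)$. *)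

(* Defs.v *)
From HB Require Import structures.
From mathcomp Require Import all_boot all_order all_algebra.
From mathcomp Require Import all_classical all_reals all_analysis.

Set Implicit Arguments.
Unset Strict Implicit.
Unset Printing Implicit Defensive.

Import Order.TTheory GRing.Theory Num.Theory.
Import numFieldNormedType.Exports.

Local Open Scope classical_set_scope.
Local Open Scope ring_scope.

Record negative_type_semimetric dX (X : measurableType dX) (R : realType)
    (d : X -> X -> R) : Prop := NegativeTypeSemimetric {
  semimetric_measurable :
    measurable_fun [set: X * X] (fun p : X * X => d p.1 p.2);
  semimetric_eq0 : forall y y', d y y' = 0 <-> y = y';
  semimetric_sym : forall y y', d y y' = d y' y;
  semimetric_negative_type : forall (m : nat) (x : 'I_m -> X) (c : 'I_m -> R),
    (2 <= m)%N -> \sum_(i < m) c i = 0 ->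
    \sum_(i < m) \sum_(j < m) c i * c j * d (x i) (x j) <= 0
}.

Section kernel.
Context dX (X : measurableType dX) (R : realType).
Variables (d : X -> X -> R) (F0 : probability X R) (y0 : X).

Definition base_kernel (y y' : X) : R := 2^-1 * (d y y0 + d y' y0 - d y y').

(* Existence of the expectations used in [centered_kernel]; [Rintegral] would
   otherwise return a default value. *)
Definition base_kernel_integrable : Prop :=
  (forall y, F0.-integrable setT (fun z => (base_kernel y z)%:E)) /\
  (F0 \x F0)%E.-integrable setT
    (fun p : X * X => (base_kernel p.1 p.2)%:E).

Definition centered_kernel (y y' : X) : R :=
  base_kernel y y' - \int[F0]_z base_kernel y z - \int[F0]_z base_kernel z y'
  + \int[(F0 \x F0)%E]_p base_kernel p.1 p.2.

End kernel.

(* Only the eigenfunctions of nonzero eigenvalues have to be orthonormal, so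
   that an expansion with finitely many terms can be padded by
   [lambda l = 0], [psi l = 0]. *)
Record eigen_expansion dX (X : measurableType dX) (R : realType)
    (k : X -> X -> R) (F0 : probability X R)
    (lambda : nat -> R) (psi : nat -> X -> R) : Prop := EigenExpansion {
  eigenvalue_ge0 : forall l, 0 <= lambda l;
  eigenfunction_measurable : forall l, measurable_fun [set: X] (psi l);
  eigenfunction_eq : forall l y',
    (\int[F0]_y (k y y' * psi l y)%:E = (lambda l * psi l y')%:E)%E;
  eigenfunction_orthonormal : forall l l',
    lambda l != 0 -> lambda l' != 0 ->
    (\int[F0]_y (psi l y * psi l' y)%:E = ((l == l')%:R)%:E)%E;
  kernel_expansion : forall y y',
    (fun N => \sum_(0 <= l < N) lambda l * psi l y * psi l y') @ \oo --> k y y'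
}.

Section feature_map.
Context dX (X : measurableType dX) (R : realType).
Variables (lambda : nat -> R) (psi : nat -> X -> R).

Definition feature (y : X) : nat -> R :=
  fun l => Num.sqrt (lambda l) * psi l y.

Definition hilbert_norm (u : nat -> R) : \bar R :=
  ('N[counting]_2%:E [EFin \o u])%E.

(* The mean of a random element of the sequence space is taken
   coordinatewise. *)
Definition feature_mean (F : probability X R) : nat -> R :=
  fun l => \int[F]_y feature y l.

Definition feature_variance (F : probability X R) : \bar R :=
  (\int[F]_y (hilbert_norm (fun l => (feature y l - feature_mean F l)%R) ^+ 2))%E.

End feature_map.

Section statistics.
Context (X : Type) (R : realType).
Variables (d : X -> X -> R) (n : nat) (y : 'I_n -> X).

(* Observation y_i is [y] at the ordinal i - 1, so i <= t reads [i < t]. *)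
Definition dbarA (t : nat) : R :=
  (t%:R * (n%:R - t%:R))^-1 *
  \sum_(i < n | (i < t)%N) \sum_(j < n | (t <= j)%N) d (y i) (y j).

Definition dbarB1 (t : nat) : R :=
  (t%:R * (t%:R - 1))^-1 *
  \sum_(i < n | (i < t)%N) \sum_(j < n | (j < t)%N && (i != j)) d (y i) (y j).

Definition dbarB2 (t : nat) : R :=
  ((n%:R - t%:R) * (n%:R - t%:R - 1))^-1 *
  \sum_(i < n | (t <= i)%N) \sum_(j < n | (t <= j)%N && (i != j))
    d (y i) (y j).

Definition T1 (t : nat) : R := dbarA t - 2^-1 * dbarB1 t - 2^-1 * dbarB2 t.

Definition T2 (t : nat) : R := `|dbarB1 t - dbarB2 t|.

Definition dbar_row (i : 'I_n) : R := n%:R^-1 * \sum_(j < n) d (y i) (y j).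

Definition dbar : R :=
  (n%:R ^+ 2)^-1 * \sum_(i < n) \sum_(j < n) d (y i) (y j).

Definition shat : R :=
  Num.sqrt (n%:R^-1 * (\sum_(i < n) dbar_row i ^+ 2) - dbar ^+ 2).

Definition nceil (rho : R) : nat := `|Num.ceil (n%:R * rho)|%N.

(* The default value is a member of the (nonempty) range, hence harmless. *)
Definition scan_max (rho0 rho1 : R) (f : nat -> R) : R :=
  \big[Num.max/f (nceil rho0)]_(nceil rho0 <= t < (nceil rho1).+1) f t.

Definition S1 (rho0 rho1 : R) : R :=
  scan_max rho0 rho1 (fun t => t%:R * (n%:R - t%:R) / n%:R * T1 t).

Definition S2 (rho0 rho1 : R) : R :=
  scan_max rho0 rho1 (fun t =>
    (2 * shat)^-1 * Num.sqrt (t%:R * (n%:R - t%:R) / n%:R) * T2 t).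

End statistics.

Definition mutually_independent d (Omega : measurableType d) (R : realType)
    (P : probability Omega R) (I : eqType) (G : I -> set (set Omega)) : Prop :=
  forall (s : seq I) (E : I -> set Omega), uniq s ->
    (forall i, i \in s -> G i (E i)) ->
    P (\big[setI/setT]_(i <- s) E i) = (\prod_(i <- s) P (E i))%E.

Definition change_point_model d (Omega : measurableType d) (R : realType)
    (P : probability Omega R) dX (X : measurableType dX) (n tau : nat)
    (y : 'I_n -> {RV P >-> X}) (F0 F1 : probability X R) : Prop :=
  [/\ mutually_independent P (fun i => g_sigma_algebra_preimage (y i)),
      forall (i : 'I_n) (A : set X), (i < tau)%N -> measurable A ->
        distribution P (y i) A = F0 A,
      forall (i : 'I_n) (A : set X), (tau <= i)%N -> measurable A ->
        distribution P (y i) A = F1 A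
    & exists2 A : set X, measurable A & F0 A <> F1 A].

(* The case s = 0 is treated apart because the library's [normal_prob m 0] is
   not the Dirac mass at [m]. *)
Definition gaussian_law (R : realType) (m v : R) (A : set R) : \bar R :=
  if v == 0 then (\d_m A)%E else normal_prob m (Num.sqrt v) A.

(* Gaussian finite-dimensional distributions are expressed through the linear
   combinations of the marginals. *)
Record brownian_bridge d (Omega : measurableType d) (R : realType)
    (P : probability Omega R) (W : R -> {RV P >-> R}) : Prop :=
  BrownianBridge {
  bridge_gaussian : forall (m : nat) (t c : 'I_m -> R) (A : set R),
    (forall i, 0 <= t i <= 1) -> measurable A ->
    P ((fun w => \sum_(i < m) c i * W (t i) w) @^-1` A) =
    gaussian_law 0
      (\sum_(i < m) \sum_(j < m)
         c i * c j * (Num.min (t i) (t j) - t i * t j)) A;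
  bridge_continuous :
    {ae P, forall w, {within `[0, 1]%classic, continuous (fun t : R => W t w)}}
}.

Definition independent_processes d (Omega : measurableType d) (R : realType)
    (P : probability Omega R) (W : nat -> R -> {RV P >-> R}) : Prop :=
  mutually_independent P (fun l =>
    <<s \bigcup_(t in `[0, 1]%classic) g_sigma_algebra_preimage (W l t) >>).

Definition is_max (R : realType) (A : set R) (m : R) : Prop :=
  A m /\ ubound A m.

(* [Q] is the law of
   max_rho (sum_l lambda_l (W_l(rho)^2 - rho (1 - rho))) / (rho (1 - rho));
   the series converges almost surely when [lambda] is summable. *)
Definition null_limit_law1 (R : realType) (lambda : nat -> R) (rho0 rho1 : R)
    (Q : probability R R) : Prop :=
  exists (d : measure_display) (Omega : measurableType d)
         (P : probability Omega R) (W : nat -> R -> {RV P >-> R})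
         (G : {RV P >-> R}),
    [/\ forall l, brownian_bridge (W l),
        independent_processes W,
        {ae P, forall w, is_max
          [set limn (fun N => \sum_(0 <= l < N)
                 lambda l * (W l rho w ^+ 2 - rho * (1 - rho)))
               / (rho * (1 - rho)) | rho in `[rho0, rho1]%classic] (G w)}
      & forall A, measurable A -> Q A = distribution P G A].

Definition null_limit_law2 (R : realType) (rho0 rho1 : R)
    (Q : probability R R) : Prop :=
  exists (d : measure_display) (Omega : measurableType d)
         (P : probability Omega R) (W : R -> {RV P >-> R})
         (G : {RV P >-> R}),
    [/\ brownian_bridge W,
        {ae P, forall w, is_max
          [set `|W rho w| / Num.sqrt (rho * (1 - rho))
            | rho in `[rho0, rho1]%classic] (G w)}
      & forall A, measurable A -> Q A = distribution P G A].

Definition upper_quantile (R : realType) (Q : probability R R) (alpha : R) : R :=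
  inf [set x : R | (Q `]x, +oo[%classic <= alpha%:E)%E].

(* Main.v *)
(** Write [phi] for the feature map, so that the centered kernel is
    [k y y' = sum_l phi_l y * phi_l y'] and [d y y' = k y y + k y' y' - 2 k y y'].
    The maxima defining S1 and S2 are bounded below by their terms at the true
    change point [t], of which [t] and [n - t] are both of order [n]; it then
    suffices that these terms tend to infinity in probability, whatever the
    (fixed) quantile is.
    For S1, [t (n - t) / n * T1 t] is, up to a bounded error, the squared norm of
    the difference of the two block means of [phi], times [t (n - t) / n].  By
    Cauchy-Schwarz it is enough to control its scalar product with a truncation
    of [mu_0 - mu_1] to finitely many coordinates, which is a weighted sum of
    bounded independent real variables: Chebyshev.
    For S2, centering of [k] under F0 gives [mu_0 = 0], hence [mu_1 = 0], so that
    the sum of [k] over a block has expectation of the order of the block size.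
    Hence T2 is [2 |v_0 - v_1|] up to an error of order [n ^ (-1/2)].  The
    normalisation [shat] is bounded, and nonzero with high probability: if it
    vanished, the row means of [d] would coincide, and comparing their averages
    over the two blocks would force [|v_0 - v_1|] to be of order [n ^ (-1/2)]. *)

Require Import Defs.
From HB Require Import structures.
From mathcomp Require Import all_boot all_order all_algebra.
From mathcomp Require Import all_classical all_reals all_analysis.
From mathcomp Require Import measurable_realfun.
From mathcomp Require Import ring lra.

Set Implicit Arguments.
Unset Strict Implicit.
Unset Printing Implicit Defensive.

Import Order.TTheory GRing.Theory Num.Theory.
Import numFieldNormedType.Exports.

Local Open Scope classical_set_scope.
Local Open Scope ring_scope.

(** * Block sums of a kernel matrix *)

Lemma sum_ord_split (R : nmodType) (n t : nat) (F : 'I_n -> R) :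
  \sum_i F i = \sum_(i < n | (i < t)%N) F i + \sum_(i < n | (t <= i)%N) F i.
Proof.
rewrite (bigID (fun i : 'I_n => (i < t)%N)) /=; congr (_ + _).
by apply: eq_bigl => i; rewrite -leqNgt.
Qed.

Lemma sum_ord_lt_const (R : realType) (n t : nat) (c : R) : (t <= n)%N ->
  \sum_(i < n | (i < t)%N) c = t%:R * c.
Proof.
move=> tn; rewrite (big_ord_narrow (F := fun=> c) tn) sumr_const card_ord.
by rewrite mulr_natl.
Qed.

Lemma sum_ord_ge_const (R : realType) (n t : nat) (c : R) : (t <= n)%N ->
  \sum_(i < n | (t <= i)%N) c = (n%:R - t%:R) * c.
Proof.
move=> tn.
have : \sum_(i < n) c = n%:R * c by rewrite sumr_const card_ord mulr_natl.
rewrite (sum_ord_split t) (sum_ord_lt_const _ tn).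
by move=> h; rewrite mulrBl -h [RHS]addrAC subrr add0r.
Qed.

(** * Deterministic identities at a fixed outcome and the lower bound for [T1] *)

Section block_sums.
Context (X : Type) (R : realType) (d : X -> X -> R) (n t : nat) (y : 'I_n -> X).
Variable K : 'I_n -> 'I_n -> R.
Hypothesis dE : forall i j, d (y i) (y j) = K i i + K j j - 2 * K i j.

Let s : R := n%:R - t%:R.
Let a := \sum_(i < n | (i < t)%N) K i i.
Let b := \sum_(i < n | (t <= i)%N) K i i.
Let K00 := \sum_(i < n | (i < t)%N) \sum_(j < n | (j < t)%N) K i j.
Let K01 := \sum_(i < n | (i < t)%N) \sum_(j < n | (t <= j)%N) K i j.
Let K11 := \sum_(i < n | (t <= i)%N) \sum_(j < n | (t <= j)%N) K i j.

Lemma sum_semimetric (p q : pred 'I_n) (cp cq : R) :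
  (forall c : R, \sum_(i | p i) c = cp * c) ->
  (forall c : R, \sum_(i | q i) c = cq * c) ->
  \sum_(i | p i) \sum_(j | q j) d (y i) (y j) =
  cq * \sum_(i | p i) K i i + cp * \sum_(j | q j) K j j
  - 2 * \sum_(i | p i) \sum_(j | q j) K i j.
Proof.
move=> hp hq.
rewrite mulr_sumr -hp -big_split /= mulr_sumr -sumrB; apply: eq_bigr => i pi.
by rewrite mulr_sumr -hq -big_split /= -sumrB; apply: eq_bigr => j _; exact: dE.
Qed.

(** [dE] makes the diagonal terms of [d] vanish, so removing them from a block changes nothing. *)
Lemma sum_semimetric_offdiag (p : pred 'I_n) (i : 'I_n) :
  \sum_(j | p j && (i != j)) d (y i) (y j) = \sum_(j | p j) d (y i) (y j).
Proof.
rewrite [RHS](bigID (fun j => i != j)) /=.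
rewrite [X in _ = _ + X]big1 ?addr0// => j /andP[_]; rewrite negbK => /eqP <-.
by rewrite dE; ring.
Qed.

(** The block sum is [2 (t a - K00)], split as [2 (t - 1) a + 2 (a - K00)]. This isolates twice the
    mean of the kernel diagonal, with a remainder of order [1 / t] once [K00] is of order [t]. *)
Lemma dbarB1E : (1 < t)%N -> (t <= n)%N ->
  dbarB1 d y t = 2 * a / t%:R + 2 * (a - K00) / (t%:R * (t%:R - 1)).
Proof.
move=> t1 tn; rewrite /dbarB1.
under eq_bigr do rewrite (sum_semimetric_offdiag (fun j => (j < t)%N)).
have ht c : \sum_(i < n | (i < t)%N) c = t%:R * c :> R.
  exact: sum_ord_lt_const.
rewrite (sum_semimetric ht ht).
have t0 : (t%:R : R) != 0 by rewrite pnatr_eq0 -lt0n ltnW.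
have t10 : (t%:R : R) - 1 != 0 by rewrite subr_eq0 pnatr_eq1 gtn_eqF.
by rewrite -/a -/K00; field; rewrite t10.
Qed.

Lemma dbarB2E : (t.+1 < n)%N ->
  dbarB2 d y t = 2 * b / s + 2 * (b - K11) / (s * (s - 1)).
Proof.
move=> tn; rewrite /dbarB2.
under eq_bigr do rewrite (sum_semimetric_offdiag (fun j => (t <= j)%N)).
have tn' : (t <= n)%N by rewrite ltnW// ltnW.
have hs c : \sum_(i < n | (t <= i)%N) c = s * c.
  exact: sum_ord_ge_const.
rewrite (sum_semimetric hs hs).
have sE : s = (n - t)%:R by rewrite natrB.
have s0 : s != 0 by rewrite sE pnatr_eq0 -lt0n subn_gt0 ltnW.
have s10 : s - 1 != 0 by rewrite subr_eq0 sE pnatr_eq1 gtn_eqF// ltn_subRL addn1.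
by rewrite -/a -/K11 -/b -/s; field; rewrite s10.
Qed.

(** The diagonal means [a / t] and [b / s] enter [dbarA] and the two halved within-block averages
    with opposite signs and cancel. *)
Lemma T1E : (1 < t)%N -> (t.+1 < n)%N ->
  T1 d y t = (K00 - a) / (t%:R * (t%:R - 1)) + (K11 - b) / (s * (s - 1))
             - 2 * K01 / (t%:R * s).
Proof.
move=> t1 tn; rewrite /T1.
have tn' : (t <= n)%N by rewrite ltnW// ltnW.
rewrite dbarB1E// dbarB2E// /dbarA.
have ht c : \sum_(i < n | (i < t)%N) c = t%:R * c :> R.
  exact: sum_ord_lt_const.
have hs c : \sum_(i < n | (t <= i)%N) c = s * c.
  exact: sum_ord_ge_const.
rewrite (sum_semimetric ht hs).
have t0 : (t%:R : R) != 0 by rewrite pnatr_eq0 -lt0n ltnW.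
have t10 : (t%:R : R) - 1 != 0 by rewrite subr_eq0 pnatr_eq1 gtn_eqF.
have sE : s = (n - t)%:R by rewrite natrB.
have s0 : s != 0 by rewrite sE pnatr_eq0 -lt0n subn_gt0 ltnW.
have s10 : s - 1 != 0 by rewrite subr_eq0 sE pnatr_eq1 gtn_eqF// ltn_subRL addn1.
rewrite -/a -/K11 -/b -/s -/K01.
field.
by rewrite t10 t0 s10 s0.
Qed.

Lemma dbar_rowE i : (0 < n)%N ->
  dbar_row d y i = K i i + (a + b) / n%:R - 2 / n%:R * \sum_j K i j.
Proof.
move=> n0; rewrite /dbar_row.
have n0' : (n%:R : R) != 0 by rewrite pnatr_eq0 -lt0n.
have hab : a + b = \sum_i K i i by rewrite [RHS](sum_ord_split t).
under eq_bigr do rewrite dE.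
rewrite sumrB big_split /= sumr_const card_ord hab -mulr_natl -mulr_sumr.
by field.
Qed.

Context (M : R).
Hypothesis KM : forall i, K i i <= M ^+ 2.
Hypothesis K00_ge0 : 0 <= K00.
Hypothesis K11_ge0 : 0 <= K11.

Lemma block0_trace_le : (t <= n)%N -> a <= t%:R * M ^+ 2.
Proof. by move=> tn; rewrite -(sum_ord_lt_const _ tn) ler_sum. Qed.

Lemma block1_trace_le : (t <= n)%N -> b <= s * M ^+ 2.
Proof. by move=> tn; rewrite -(sum_ord_ge_const _ tn) ler_sum. Qed.

(** Passing from the off-diagonal average to the full one: replacing [t (t - 1)] by [t ^ 2] only
    lowers [K00 / (t (t - 1))], and the diagonal costs at most [2 M ^ 2 / t], because
    [a <= t M ^ 2 <= 2 M ^ 2 (t - 1)] for [t >= 2]. Weighted by [t s / n], the costs of both blocks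
    add up to [2 M ^ 2], within the allowed [4 M ^ 2]. *)
Lemma T1_lower : (1 < t)%N -> (t.+1 < n)%N ->
  t%:R * s / n%:R * (K00 / t%:R ^+ 2 + K11 / s ^+ 2 - 2 * K01 / (t%:R * s))
    - 4 * M ^+ 2 <= t%:R * s / n%:R * T1 d y t.
Proof.
move=> t1 tn; rewrite T1E//.
have tn' : (t <= n)%N by rewrite ltnW// ltnW.
have := block0_trace_le tn'; have := block1_trace_le tn'.
have sE : s = (n - t)%:R by rewrite natrB.
have ht : 2 <= t%:R :> R by rewrite ler_nat.
have hs : 2 <= s by rewrite sE ler_nat leq_subRL// addn2.
have nE : n%:R = t%:R + s by rewrite /s addrCA subrr addr0.
rewrite nE; move: (t%:R : R) s ht hs => u v hu hv hb ha.
have A1 : (K00 - a) / (u * (u - 1)) >= K00 / u ^+ 2 - 2 * M ^+ 2 / u.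
  have -> : (K00 - a) / (u * (u - 1)) = K00 / (u * (u - 1)) - a / (u * (u - 1)).
    by rewrite mulrBl.
  apply: lerB.
    apply: ler_wpM2l => //; rewrite lef_pV2 ?posrE; nra.
  rewrite ler_pdivrMr; last nra.
  have -> : 2 * M ^+ 2 / u * (u * (u - 1)) = 2 * M ^+ 2 * (u - 1).
    by field; lra.
  have := sqr_ge0 M; nra.
have A2 : (K11 - b) / (v * (v - 1)) >= K11 / v ^+ 2 - 2 * M ^+ 2 / v.
  have -> : (K11 - b) / (v * (v - 1)) = K11 / (v * (v - 1)) - b / (v * (v - 1)).
    by rewrite mulrBl.
  apply: lerB.
    apply: ler_wpM2l => //; rewrite lef_pV2 ?posrE; nra.
  rewrite ler_pdivrMr; last nra.
  have -> : 2 * M ^+ 2 / v * (v * (v - 1)) = 2 * M ^+ 2 * (v - 1).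
    by field; lra.
  have := sqr_ge0 M; nra.
have c0 : 0 <= u * v / (u + v) by apply: divr_ge0; nra.
have := ler_wpM2l c0 (lerD A1 A2).
have E : u * v / (u + v) * (2 * M ^+ 2 / u + 2 * M ^+ 2 / v) = 2 * M ^+ 2.
  by field; lra.
have := sqr_ge0 M.
move: (K00 / u ^+ 2) (K11 / v ^+ 2) (2 * K01 / (u * v)) E.
move: ((K00 - a) / (u * (u - 1))) ((K11 - b) / (v * (v - 1))).
move: (2 * M ^+ 2 / u) (2 * M ^+ 2 / v) (u * v / (u + v)).
by move=> *; nra.
Qed.

End block_sums.

(** * Deterministic bounds for [T2] and for the normalisation [shat] *)

Section block_statistics2.
Context (X : Type) (R : realType) (d : X -> X -> R) (n t : nat) (y : 'I_n -> X).
Variable K : 'I_n -> 'I_n -> R.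
Hypothesis dE : forall i j, d (y i) (y j) = K i i + K j j - 2 * K i j.
Hypothesis Ksym : forall i j, K i j = K j i.

Let s : R := n%:R - t%:R.
Let a := \sum_(i < n | (i < t)%N) K i i.
Let b := \sum_(i < n | (t <= i)%N) K i i.
Let K00 := \sum_(i < n | (i < t)%N) \sum_(j < n | (j < t)%N) K i j.
Let K01 := \sum_(i < n | (i < t)%N) \sum_(j < n | (t <= j)%N) K i j.
Let K11 := \sum_(i < n | (t <= i)%N) \sum_(j < n | (t <= j)%N) K i j.

(** [L] bounds the within-block kernel sums per observation, [m] bounds both block sizes minus one
    from below, and [v] stands for the difference of the variances [v_0 - v_1]. *)
Context (M L m v : R).
Hypothesis t1 : (1 < t)%N.
Hypothesis tn : (t.+1 < n)%N.
Hypothesis m_gt0 : 0 < m.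
Hypothesis mt : m <= t%:R - 1.
Hypothesis ms : m <= s - 1.
Hypothesis K_bound : forall i j, `|K i j| <= M ^+ 2.
Hypothesis Kdiag_ge0 : forall i, 0 <= K i i.
Hypothesis K00_ge0 : 0 <= K00.
Hypothesis K11_ge0 : 0 <= K11.
Hypothesis K01_le : `|K01| <= (K00 + K11) / 2.
Hypothesis K00_le : K00 <= L * t%:R.
Hypothesis K11_le : K11 <= L * s.
Hypothesis mean_close : `|a / t%:R - b / s - v| <= `|v| / 2.
Hypothesis v_large : 12 * (M ^+ 2 + L) < `|v| * m.

Let tn' : (t <= n)%N. Proof. by rewrite ltnW// ltnW. Qed.

Let n_gt0 : (0 < n)%N. Proof. exact: leq_trans (ltnW t1) tn'. Qed.

Let nR_gt0 : 0 < n%:R :> R. Proof. by rewrite ltr0n. Qed.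

Let mean_diff_ge : `|v| / 2 <= `|a / t%:R - b / s|.
Proof.
have := ler_normB (a / t%:R - b / s) (a / t%:R - b / s - v).
rewrite opprB addrCA subrr addr0; have := mean_close; lra.
Qed.

Let Kdiag_le i : K i i <= M ^+ 2.
Proof. exact: le_trans (ler_norm _) (K_bound i i). Qed.

(** Twice the difference of the diagonal means is at least [|v|] in absolute value, and [v_large]
    keeps each of the two remainders below [|v| / 4]. *)
Lemma T2_lower : `|v| / 2 <= T2 d y t.
Proof.
rewrite /T2 (dbarB1E dE)// (dbarB2E dE)// -/a -/b -/K00 -/K11 -/s.
have L0 : 0 <= L.
  have : 0 <= L * t%:R by exact: le_trans K00_le.
  by rewrite pmulr_lge0// ltr0n ltnW.
have a0 : 0 <= a by exact: sumr_ge0.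
have b0 : 0 <= b by exact: sumr_ge0.
have ha : a <= t%:R * M ^+ 2 by exact: block0_trace_le.
have hb : b <= s * M ^+ 2 by exact: block1_trace_le.
have corr w u K' : m <= u - 1 -> 0 <= w -> w <= u * M ^+ 2 -> 0 <= K' ->
    K' <= L * u -> `|2 * (w - K') / (u * (u - 1))| <= 2 * (M ^+ 2 + L) / m.
  move=> mu w0 wle k0 kle.
  have u0 : 0 < u * (u - 1) by move: m_gt0 => h; nra.
  rewrite normrM [`|_^-1|]gtr0_norm ?invr_gt0// ler_pdivrMr//.
  have hm : 2 * (M ^+ 2 + L) * u <= 2 * (M ^+ 2 + L) / m * (u * (u - 1)).
    rewrite -!mulrA ler_pM2l// ler_wpM2l// ?addr_ge0 ?sqr_ge0//.
    rewrite mulrCA ler_peMr//; first by move: m_gt0 => h; lra.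
    by rewrite ler_pdivlMl ?mulr1.
  apply: le_trans hm.
  rewrite ler_norml; have := sqr_ge0 M; move: m_gt0 => h0 h1; apply/andP; split; nra.
have c1 := corr a t%:R K00 mt a0 ha K00_ge0 K00_le.
have c2 := corr b s K11 ms b0 hb K11_ge0 K11_le.
have vm : 2 * (M ^+ 2 + L) / m <= `|v| / 4.
  rewrite ler_pdivrMr//; have := sqr_ge0 M; have := v_large; nra.
have h := mean_diff_ge.
move: c1 c2 vm; set p := 2 * (a - K00) / _; set q := 2 * (b - K11) / _.
move=> c1 c2 vm.
have -> : 2 * a / t%:R + p - (2 * b / s + q) = 2 * (a / t%:R - b / s) + (p - q).
  by rewrite mulrBr !mulrA; ring.
have h1 := lerB_normD (2 * (a / t%:R - b / s)) (p - q).
have h2 := ler_normB p q.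
move: h1; rewrite normrM ger0_norm//; lra.
Qed.

Let r := dbar_row d y.

Lemma dbarE : dbar d y = n%:R^-1 * \sum_i r i.
Proof. by rewrite /dbar /r /dbar_row -mulr_sumr mulrA expr2 invfM. Qed.

(** The radicand as a mean squared deviation: it can only be nonpositive if all row means agree. *)
Lemma shat_arg :
  n%:R^-1 * (\sum_i r i ^+ 2) - dbar d y ^+ 2 =
  n%:R^-1 * \sum_i (r i - dbar d y) ^+ 2.
Proof.
have n0 := lt0r_neq0 nR_gt0.
under [in RHS]eq_bigr do rewrite sqrrB.
rewrite big_split /= sumrB sumr_const card_ord.
rewrite sumrMnl -mulr_suml.
have -> : \sum_i r i = n%:R * dbar d y by rewrite dbarE mulrA divff ?mul1r.
rewrite -mulr_natl; by field.
Qed.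

(** [dE] bounds [d] by [4 M ^ 2] at the observations, hence also the row means and the root of their
    mean square. *)
Lemma shat_le : shat d y <= 4 * M ^+ 2.
Proof.
have M0 := sqr_ge0 M.
have M4 : 0 <= 4 * M ^+ 2 by lra.
rewrite /shat -[leRHS](ger0_norm M4) -sqrtr_sqr ler_wsqrtr//.
have rb i : r i ^+ 2 <= (4 * M ^+ 2) ^+ 2.
  rewrite -real_normK ?num_real// ler_sqr ?nnegrE//.
  rewrite /r /dbar_row normrM gtr0_norm ?invr_gt0// ler_pdivrMl//.
  apply: le_trans (ler_norm_sum _ _ _) _.
  apply: (@le_trans _ _ (\sum_(j < n) 4 * M ^+ 2)); last first.
    by rewrite sumr_const card_ord [leRHS]mulr_natl.
  apply: ler_sum => j _.
  rewrite dE; have := K_bound i i; have := K_bound j j; have := K_bound i j.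
  rewrite !ler_norml => /andP[? ?] /andP[? ?] /andP[? ?]; apply/andP; lra.
apply: (@le_trans _ _ (n%:R^-1 * (\sum_i r i ^+ 2))).
  by rewrite lerBlDr lerDl sqr_ge0.
rewrite ler_pdivrMl//.
apply: (@le_trans _ _ (\sum_(j < n) (4 * M ^+ 2) ^+ 2)); first exact: ler_sum.
by rewrite sumr_const card_ord [leRHS]mulr_natl.
Qed.

Lemma shat_gt0 : 0 < shat d y.
Proof.
rewrite lt_neqAle sqrtr_ge0 andbT eq_sym; apply/negP => /eqP shat0.
have n0 := nR_gt0.
have rE i : r i = dbar d y.
  apply/eqP; rewrite -subr_eq0 -sqrf_eq0 -[_ == 0]andTb.
  (* [Num.sqrt] is 0 on all nonpositive reals, so [shat = 0] yields only this inequality; the sum of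
     squares being nonnegative, that suffices. *)
  have : n%:R^-1 * \sum_i (r i - dbar d y) ^+ 2 <= 0.
    by rewrite -shat_arg -sqrtr_eq0; apply/eqP.
  rewrite pmulr_rle0 ?invr_gt0// => h.
  have /eqP : \sum_i (r i - dbar d y) ^+ 2 = 0.
    by apply/eqP; rewrite eq_le h sumr_ge0// => j _; exact: sqr_ge0.
  rewrite psumr_eq0 => [/allP/(_ i)/=|j _]; last exact: sqr_ge0.
  by apply; rewrite mem_index_enum.
have t0 : 0 < t%:R :> R by rewrite ltr0n ltnW.
have s0 : 0 < s by move: ms m_gt0 => ? ?; lra.
have nE : n%:R = t%:R + s by rewrite /s addrCA subrr addr0.
(* Summing the equal row means over one block brings in the trace of that block; dividing by the
   block size and subtracting the analogue for the other block eliminates [dbar] and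
   [(a + b) / n]. *)
have E0 : t%:R * dbar d y =
    a + t%:R * ((a + b) / n%:R) - 2 / n%:R * (K00 + K01).
  rewrite -(sum_ord_lt_const _ tn') -(sum_ord_lt_const _ tn').
  rewrite -big_split /= -[K00 + K01]big_split /= mulr_sumr -sumrB.
  apply: eq_bigr => i _; rewrite -(rE i) /r (dbar_rowE t dE)//.
  by congr (_ - _ * _); exact: sum_ord_split.
have E1 : s * dbar d y = b + s * ((a + b) / n%:R) - 2 / n%:R * (K01 + K11).
  have -> : K01 + K11 = \sum_(i < n | (t <= i)%N)
      (\sum_(j < n | (j < t)%N) K i j + \sum_(j < n | (t <= j)%N) K i j).
    rewrite big_split /=; congr (_ + _).
    by rewrite /K01 exchange_big; apply: eq_bigr => j _; exact: eq_bigr.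
  rewrite -(sum_ord_ge_const _ tn') -(sum_ord_ge_const _ tn').
  rewrite -big_split /= mulr_sumr -sumrB.
  apply: eq_bigr => i _; rewrite -(rE i) /r (dbar_rowE t dE)//.
  by congr (_ - _ * _); exact: sum_ord_split.
have E : a / t%:R - b / s =
    2 / n%:R * ((K00 + K01) / t%:R - (K01 + K11) / s).
  have F0 : a / t%:R = dbar d y - (a + b) / n%:R + 2 / n%:R * ((K00 + K01) / t%:R).
    have h : a = t%:R * dbar d y - t%:R * ((a + b) / n%:R) + 2 / n%:R * (K00 + K01).
      by rewrite E0; ring.
    by rewrite [in LHS]h; field; rewrite !gt_eqF.
  have F1 : b / s = dbar d y - (a + b) / n%:R + 2 / n%:R * ((K01 + K11) / s).
    have h : b = s * dbar d y - s * ((a + b) / n%:R) + 2 / n%:R * (K01 + K11).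
      by rewrite E1; ring.
    by rewrite [in LHS]h; field; rewrite !gt_eqF.
  by rewrite F0 F1; ring.
have L0 : 0 <= L.
  have : 0 <= L * t%:R by exact: le_trans K00_le.
  by rewrite pmulr_lge0.
have K01n : `|K01| <= L * n%:R / 2.
  apply: le_trans K01_le _; rewrite ler_pM2r// nE mulrDr; exact: lerD.
have K01u u : m <= u - 1 -> `|K01 / u| <= L * n%:R / 2 / m.
  move=> mu; have u0 : 0 < u by move: m_gt0 => ?; lra.
  rewrite normrM [`|u^-1|]gtr0_norm ?invr_gt0//.
  apply: ler_pM => //; first by rewrite invr_ge0 ltW.
  by rewrite lef_pV2 ?posrE//; lra.
have c1 : `|K00 / t%:R| <= L by rewrite ger0_norm ?divr_ge0 ?(ltW t0)// ler_pdivrMr.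
have c2 : `|K11 / s| <= L by rewrite ger0_norm ?divr_ge0 ?(ltW s0)// ler_pdivrMr.
have c3 := K01u _ mt; have c4 := K01u _ ms.
have := mean_diff_ge; apply/negP; rewrite -ltNge E normrM gtr0_norm ?divr_gt0//.
have nm : m <= n%:R by rewrite nE; move: mt s0; lra.
have : `|(K00 + K01) / t%:R - (K01 + K11) / s| <= 2 * L + L * n%:R / m.
  rewrite !mulrDl opprD; move: c1 c2 c3 c4; rewrite !ler_norml.
  have -> : L * n%:R / 2 / m = L * n%:R / m / 2 by field; rewrite gt_eqF.
  move=> /andP[? ?] /andP[? ?] /andP[? ?] /andP[? ?]; apply/andP; lra.
(* The right-hand side is at most [4 L / n + 2 L / m], and [m <= n]; [v_large] then puts [6 L / m]
   below [|v| / 2], against [mean_diff_ge]. *)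
move=> h; apply: le_lt_trans (_ : 6 * L / m < _).
  apply: le_trans (ler_wpM2l _ h) _; first by rewrite divr_ge0.
  have -> : 2 / n%:R * (2 * L + L * n%:R / m) = 4 * L / n%:R + 2 * L / m.
    by field; rewrite !gt_eqF.
  have -> : 6 * L / m = 4 * L / m + 2 * L / m by field; rewrite gt_eqF.
  rewrite lerD2r ler_wpM2l ?mulr_ge0// lef_pV2 ?posrE//.
rewrite ltr_pdivrMr//; have := sqr_ge0 M; have := v_large; lra.
Qed.

End block_statistics2.

(** * Quadratic forms of the kernel *)

(** Lagrange's identity: the difference of the two sides is half the double sum of the squares
    [(u i * v j - u j * v i) ^ 2]. *)
Lemma finite_cauchy_schwarz (R : realFieldType) (I : Type) (r : seq I)
    (u v : I -> R) :
  (\sum_(i <- r) u i * v i) ^+ 2 <=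
  (\sum_(i <- r) u i ^+ 2) * (\sum_(i <- r) v i ^+ 2).
Proof.
have : 0 <= \sum_(i <- r) \sum_(j <- r) (u i * v j - u j * v i) ^+ 2.
  by apply: sumr_ge0 => i _; apply: sumr_ge0 => j _; exact: sqr_ge0.
have -> : \sum_(i <- r) \sum_(j <- r) (u i * v j - u j * v i) ^+ 2 =
    (\sum_(i <- r) u i ^+ 2) * (\sum_(i <- r) v i ^+ 2) * 2 -
    (\sum_(i <- r) u i * v i) ^+ 2 * 2.
  set U := \sum_(i <- r) u i ^+ 2; set V := \sum_(i <- r) v i ^+ 2.
  set W := \sum_(i <- r) u i * v i.
  have -> : U * V * 2 - W ^+ 2 * 2 =
    \sum_(i <- r) (u i ^+ 2 * V - 2 * (u i * v i * W) + v i ^+ 2 * U).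
    by rewrite big_split sumrB /= -!mulr_suml -mulr_sumr -mulr_suml -/U -/V -/W; ring.
  apply: eq_bigr => i _.
  transitivity (\sum_(j <- r)
      (u i ^+ 2 * v j ^+ 2 - 2 * (u i * v i * (u j * v j)) + v i ^+ 2 * u j ^+ 2)).
    by apply: eq_bigr => j _; ring.
  by rewrite big_split sumrB /= -!mulr_sumr.
by rewrite subr_ge0 ler_pM2r.
Qed.

Section kernel_forms.
Context (X : Type) (R : realType) (k : X -> X -> R) (phi : nat -> X -> R).
Hypothesis phiE : forall y y',
  (fun N => \sum_(0 <= l < N) phi l y * phi l y') @ \oo --> k y y'.

Lemma kernel_sym y y' : k y y' = k y' y.
Proof.
rewrite -(cvg_lim _ (@phiE y y'))// -(cvg_lim _ (@phiE y' y))//.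
congr (limn _); apply/funext => N; apply: eq_bigr => l _; exact: mulrC.
Qed.

(** On the diagonal the expansion has nonnegative terms, so its partial sums increase to their
    limit. *)
Lemma partial_norm_le y N : \sum_(0 <= l < N) phi l y ^+ 2 <= k y y.
Proof.
have nd : nondecreasing_seq (fun N => \sum_(0 <= l < N) phi l y * phi l y).
  apply/nondecreasing_seqP => m; rewrite big_nat_recr//= lerDl -expr2.
  exact: sqr_ge0.
have := nondecreasing_cvgn_le nd (cvgP _ (@phiE y y)) N.
by rewrite (cvg_lim _ (@phiE y y)).
Qed.

Lemma kernel_diag_ge0 y : 0 <= k y y.
Proof. by have := partial_norm_le y 0; rewrite big_geq. Qed.

(** Termwise [2 |a b| <= a ^ 2 + b ^ 2]. The bound is uniform in [N], which later provides the
    domination needed to integrate the expansion. *)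
Lemma partial_kernel_le (B : R) y y' N : k y y <= B -> k y' y' <= B ->
  `|\sum_(0 <= l < N) phi l y * phi l y'| <= B.
Proof.
move=> hy hy'; apply: le_trans (ler_norm_sum _ _ _) _.
apply: (@le_trans _ _ (\sum_(0 <= l < N) (phi l y ^+ 2 / 2 + phi l y' ^+ 2 / 2))).
  apply: ler_sum => l _; rewrite ler_norml; apply/andP.
  have := sqr_ge0 (phi l y - phi l y'); have := sqr_ge0 (phi l y + phi l y').
  rewrite !expr2; split; nra.
rewrite big_split /= -!mulr_suml.
have := partial_norm_le y N; have := partial_norm_le y' N; lra.
Qed.

Lemma kernel_le (B : R) y y' : k y y <= B -> k y' y' <= B -> `|k y y'| <= B.
Proof.
move=> hy hy'; apply: (cvgr_to_le (cvg_norm (@phiE y y'))).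
by apply: nearW => N; exact: partial_kernel_le.
Qed.

Context (n : nat) (x : 'I_n -> X).

(** The quadratic form is the squared norm of [sum_i c_i phi(x_i)], read coordinate by coordinate;
    the sums over [i] and [j] are finite, so they commute with the limit. *)
Lemma kernel_form_cvg (c : 'I_n -> R) :
  (fun N => \sum_(0 <= l < N) (\sum_i c i * phi l (x i)) ^+ 2) @ \oo -->
  \sum_i \sum_j c i * c j * k (x i) (x j).
Proof.
have -> : (fun N => \sum_(0 <= l < N) (\sum_i c i * phi l (x i)) ^+ 2) =
  (fun N => \sum_i \sum_j c i * c j *
     \sum_(0 <= l < N) phi l (x i) * phi l (x j)).
  apply/funext => N.
  under [RHS]eq_bigr => i _ do under eq_bigr => j _ do rewrite mulr_sumr.
  under [RHS]eq_bigr => i _ do rewrite exchange_big.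
  rewrite [RHS]exchange_big /=; apply: eq_bigr => l _.
  rewrite expr2 mulr_suml; apply: eq_bigr => i _; rewrite mulr_sumr.
  by apply: eq_bigr => j _; ring.
apply: cvg_big => [|i _]; first exact: add_continuous.
apply: cvg_big => [|j _]; first exact: add_continuous.
by apply: cvgM; [exact: cvg_cst|exact: phiE].
Qed.

Lemma kernel_form_ge (c : 'I_n -> R) N :
  \sum_(0 <= l < N) (\sum_i c i * phi l (x i)) ^+ 2 <=
  \sum_i \sum_j c i * c j * k (x i) (x j).
Proof.
set f := (fun N => \sum_(0 <= l < N) (\sum_i c i * phi l (x i)) ^+ 2).
have nd : nondecreasing_seq f.
  by apply/nondecreasing_seqP => m; rewrite /f big_nat_recr//= lerDl sqr_ge0.
have := nondecreasing_cvgn_le nd (cvgP _ (@kernel_form_cvg c)) N.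
by rewrite (cvg_lim _ (@kernel_form_cvg c)).
Qed.

Lemma kernel_form_ge0 (c : 'I_n -> R) :
  0 <= \sum_i \sum_j c i * c j * k (x i) (x j).
Proof. by have := kernel_form_ge c 0; rewrite big_geq. Qed.

Lemma kernel_form_cauchy_schwarz (c : 'I_n -> R) (delta : nat -> R) N :
  (\sum_(0 <= l < N) delta l * \sum_i c i * phi l (x i)) ^+ 2 <=
  (\sum_(0 <= l < N) delta l ^+ 2) * \sum_i \sum_j c i * c j * k (x i) (x j).
Proof.
apply: le_trans (finite_cauchy_schwarz _ _ _) _.
apply: ler_wpM2l; last exact: kernel_form_ge.
by apply: sumr_ge0 => l _; exact: sqr_ge0.
Qed.

Context (t : nat).
Let K00 := \sum_(i < n | (i < t)%N) \sum_(j < n | (j < t)%N) k (x i) (x j).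
Let K01 := \sum_(i < n | (i < t)%N) \sum_(j < n | (t <= j)%N) k (x i) (x j).
Let K11 := \sum_(i < n | (t <= i)%N) \sum_(j < n | (t <= j)%N) k (x i) (x j).

(** Coefficients constant on each block. The values 0 and 1 give the positivity of the block sums, 1
    and -1 the bound on the cross term, and [1 / t], [- 1 / s] the squared distance between the
    block means of the features. *)
Lemma kernel_form_blocks (u v : R) :
  \sum_(i < n) \sum_(j < n)
    (if (i < t)%N then u else v) * (if (j < t)%N then u else v) *
    k (x i) (x j) = u ^+ 2 * K00 + 2 * (u * v) * K01 + v ^+ 2 * K11.
Proof.
have K10 : K01 =
    \sum_(i < n | (t <= i)%N) \sum_(j < n | (j < t)%N) k (x i) (x j).
  rewrite /K01 exchange_big; apply: eq_bigr => j _; apply: eq_bigr => i _.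
  exact: kernel_sym.
have E (p q : pred 'I_n) (f : 'I_n -> R) (w z : R) : (forall i, p i -> f i = w) ->
   (forall i, q i -> f i = z) ->
   \sum_(i | p i) \sum_(j | q j) f i * f j * k (x i) (x j) =
   w * z * \sum_(i | p i) \sum_(j | q j) k (x i) (x j).
  move=> hp hq; rewrite mulr_sumr; apply: eq_bigr => i pi; rewrite mulr_sumr.
  by apply: eq_bigr => j qj; rewrite hp// hq.
pose f (i : 'I_n) := if (i < t)%N then u else v.
have h1 (i : 'I_n) : (i < t)%N -> f i = u by rewrite /f => ->.
have h2 (i : 'I_n) : (t <= i)%N -> f i = v by rewrite /f leqNgt => /negbTE ->.
rewrite (sum_ord_split t); under eq_bigr do rewrite (sum_ord_split t).
under [X in _ + X = _]eq_bigr do rewrite (sum_ord_split t).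
rewrite !big_split /=.
rewrite (E _ _ f _ _ h1 h1) (E _ _ f _ _ h1 h2).
rewrite (E _ _ f _ _ h2 h1) (E _ _ f _ _ h2 h2).
by rewrite -/K00 -/K01 -/K11 -K10; ring.
Qed.

Lemma kernel_block0_ge0 : 0 <= K00.
Proof. by have := kernel_form_ge0 (fun i => if (i < t)%N then 1 else 0);
  rewrite kernel_form_blocks; lra. Qed.

Lemma kernel_block1_ge0 : 0 <= K11.
Proof. by have := kernel_form_ge0 (fun i => if (i < t)%N then 0 else 1);
  rewrite kernel_form_blocks; lra. Qed.

Lemma kernel_block01_le : `|K01| <= (K00 + K11) / 2.
Proof.
have := kernel_form_ge0 (fun i => if (i < t)%N then 1 else 1).
have := kernel_form_ge0 (fun i => if (i < t)%N then 1 else -1).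
rewrite !kernel_form_blocks => h1 h2; rewrite ler_norml; apply/andP; lra.
Qed.

End kernel_forms.

(** * Bounded measurable functions *)

(** Boundedness is required everywhere, not almost everywhere, so that the class is closed under
    composition with any measurable map and is integrable for every probability. *)
Definition bounded_measurable d (T : measurableType d) (R : realType)
    (f : T -> R) : Prop :=
  measurable_fun [set: T] f /\ exists B, forall x, `|f x| <= B.

Section bounded_measurable_theory.
Context d (T : measurableType d) (R : realType).
Implicit Types f g : T -> R.

Lemma bounded_measurable_cst (c : R) :
  bounded_measurable (fun _ : T => c).
Proof. by split; [exact: measurable_cst|exists `|c|]. Qed.

Lemma bounded_measurableD f g : bounded_measurable f -> bounded_measurable g ->
  bounded_measurable (fun x => f x + g x).
Proof.
move=> [mf [B hB]] [mg [C hC]]; split; first exact: measurable_funD.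
by exists (B + C) => x; apply: le_trans (ler_normD _ _) _; exact: lerD.
Qed.

Lemma bounded_measurableM f g : bounded_measurable f -> bounded_measurable g ->
  bounded_measurable (fun x => f x * g x).
Proof.
move=> [mf [B hB]] [mg [C hC]]; split; first exact: measurable_funM.
by exists (B * C) => x; rewrite normrM; exact: ler_pM.
Qed.

Lemma bounded_measurableB f g : bounded_measurable f -> bounded_measurable g ->
  bounded_measurable (fun x => f x - g x).
Proof.
move=> [mf [B hB]] [mg [C hC]]; split; first exact: measurable_funB.
by exists (B + C) => x; apply: le_trans (ler_normB _ _) _; exact: lerD.
Qed.

Lemma bounded_measurable_sum (I : Type) (r : seq I) (h : I -> T -> R) :
  (forall i, bounded_measurable (h i)) ->
  bounded_measurable (fun x => \sum_(i <- r) h i x).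
Proof.
move=> hh; elim: r => [|i r IH].
  under eq_fun do rewrite big_nil; exact: bounded_measurable_cst.
by under eq_fun do rewrite big_cons; exact: bounded_measurableD.
Qed.

Lemma bounded_measurable_comp d' (T' : measurableType d') (f : T -> R)
  (g : T' -> T) : bounded_measurable f -> measurable_fun [set: T'] g ->
  bounded_measurable (fun x => f (g x)).
Proof.
move=> [mf [B hB]] mg; split; first exact: (measurableT_comp mf).
by exists B.
Qed.

Lemma measurable_set_ge f (eps : R) : measurable_fun [set: T] f ->
  measurable [set x | eps <= f x].
Proof.
move=> mf; have -> : [set x | eps <= f x] = f @^-1` [set` `[eps, +oo[].
  by apply/seteqP; split => x /=; rewrite in_itv/= andbT.
by rewrite -[X in measurable X]setTI; exact: mf.
Qed.

Lemma measurable_set_gt f (eps : R) : measurable_fun [set: T] f ->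
  measurable [set x | eps < f x].
Proof.
move=> mf; have -> : [set x | eps < f x] = f @^-1` [set` `]eps, +oo[].
  by apply/seteqP; split => x /=; rewrite in_itv/= andbT.
by rewrite -[X in measurable X]setTI; exact: mf.
Qed.

Variable P : probability T R.

Lemma ae_ord_forall (n : nat) (Q : 'I_n -> T -> Prop) :
  (forall i, {ae P, forall x, Q i x}) -> {ae P, forall x, forall i, Q i x}.
Proof.
move=> hQ.
(* Padding with [True] turns the finite family into a sequence, to which countable intersection
   applies. *)
pose Q' m x := if insub m is Some i then Q i x else True.
have : {ae P, forall x, forall m, Q' m x}.
  apply/ae_foralln => m; rewrite /Q'; case: insubP => [i _ _|_]; first exact: hQ.
  exact: aeW.
by apply: filterS => x h i; have := h i; rewrite /Q' valK.
Qed.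

(** The complement of [E] is covered by the bad event [B] and a null set. *)
Lemma probability_ge_of_bad (E B : set T) (eps : R) :
  measurable E -> measurable B -> (P B <= eps%:E)%E ->
  {ae P, forall x, ~ B x -> E x} -> ((1 - eps)%:E <= P E)%E.
Proof.
move=> mE mB PB ae.
have PEB : (P (~` E) <= P B)%E.
  have mD : measurable (~` E `\` B) by apply: measurableD => //; exact: measurableC.
  have D0 : P (~` E `\` B) = 0%E.
    apply/negligibleP => //; apply: negligibleS ae => x [nE nB] /=.
    by move=> h; exact/nE/h.
  apply: (@le_trans _ _ (P (B `|` (~` E `\` B)))).
    apply: le_measure; rewrite ?inE//; first exact: measurableC.
      exact: measurableU.
    by move=> x nE; have [Bx|nB] := pselect (B x); [left|right].
  by apply: le_trans (measureU2 _ _ _) _ => //; rewrite [X in (_ + X)%E]D0 adde0.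
have := le_trans PEB PB; rewrite probability_setC//.
by move=> h; rewrite EFinB leeBlDr// -leeBlDl ?fin_num_measure.
Qed.

Lemma bounded_measurable_integrable f : bounded_measurable f ->
  P.-integrable [set: T] (EFin \o f).
Proof.
move=> [mf [B hB]]; apply: measurable_bounded_integrable => //.
  by apply: (le_lt_trans (probability_le1 P _)) => //; exact: ltry.
exists B; split; first exact: num_real.
by move=> x Bx y _; exact: le_trans (hB y) (ltW Bx).
Qed.

Lemma integral_bounded_measurable f : bounded_measurable f ->
  (\int[P]_x (f x)%:E)%E = (\int[P]_x f x)%:E.
Proof.
move=> hf; rewrite /Rintegral fineK//; apply: integrable_fin_num => //.
exact: bounded_measurable_integrable.
Qed.

Lemma Rintegral_sum (I : Type) (r : seq I) (h : I -> T -> R) :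
  (forall i, bounded_measurable (h i)) ->
  \int[P]_x (\sum_(i <- r) h i x) = \sum_(i <- r) \int[P]_x h i x.
Proof.
move=> hh; elim: r => [|i r IH].
  rewrite big_nil; under eq_Rintegral do rewrite big_nil.
  by rewrite Rintegral_cst// mul0r.
rewrite big_cons -IH; under eq_Rintegral do rewrite big_cons.
by rewrite RintegralD//; apply: bounded_measurable_integrable => //;
  exact: bounded_measurable_sum.
Qed.

Lemma Rintegral_le f g : bounded_measurable f -> bounded_measurable g ->
  (forall x, f x <= g x) -> \int[P]_x f x <= \int[P]_x g x.
Proof.
by move=> hf hg fg; apply: le_Rintegral => //; exact: bounded_measurable_integrable.
Qed.

Lemma Rintegral_prob_cst (c : R) : \int[P]_x c = c.
Proof.
rewrite Rintegral_cst// -[RHS]mulr1 -[1 in RHS]/(fine 1%E); congr (_ * fine _).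
exact: probability_setT.
Qed.

Lemma Rintegral_dominated_cvg (f_ : nat -> T -> R) f (B : R) :
  (forall N, measurable_fun [set: T] (f_ N)) -> (forall N x, `|f_ N x| <= B) ->
  (forall x, f_ ^~ x @ \oo --> f x) ->
  (fun N => \int[P]_x f_ N x) @ \oo --> \int[P]_x f x.
Proof.
move=> mf_ fB ff; have mf : measurable_fun [set: T] f.
  by apply: (measurable_fun_cvg mf_) => x _; exact: ff.
have bf_ N : bounded_measurable (f_ N) by split => //; exists B.
have bf : bounded_measurable f.
  split => //; exists B => x; apply: (cvgr_to_le (cvg_norm (@ff x))).
  by apply: nearW => N.
have [|||||_ _] := @dominated_convergence _ _ _ P _ measurableT
  (fun N x => (f_ N x)%:E) (EFin \o f) (cst B%:E).
- by move=> N; apply/measurable_EFinP.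
- exact/measurable_EFinP.
- by apply: aeW => x _; apply: cvg_EFin; [exact: nearW|exact: ff].
- exact: (bounded_measurable_integrable (bounded_measurable_cst B)).
- by apply: aeW => x N _; rewrite lee_fin.
rewrite integral_bounded_measurable//.
under eq_fun do rewrite integral_bounded_measurable//.
by move/fine_cvgP => [].
Qed.

Lemma Rintegral_markov f (eps : R) : bounded_measurable f ->
  (forall x, 0 <= f x) -> 0 < eps ->
  (P [set x | (eps <= f x)%R] <= ((\int[P]_x f x) / eps)%:E)%E.
Proof.
move=> hf f0 e0; have mf := hf.1.
have mA := measurable_set_ge eps mf.
rewrite mulrC EFinM -lee_pdivrMl ?invr_gt0// invrK.
rewrite -integral_bounded_measurable//.
apply: (@le_trans _ _ (\int[P]_x ((eps * \1_[set x | eps <= f x] x)%:E))%E).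
  under eq_integral do rewrite EFinM.
  rewrite integralZl//; last exact: integrable_indic.
  by rewrite integral_indic// setIT.
apply: ge0_le_integral => //.
- by move=> x _; rewrite lee_fin mulr_ge0 // ltW.
- apply/measurable_EFinP; apply: measurable_funM; first exact: measurable_cst.
  exact: measurable_indic.
- exact/measurable_EFinP.
- move=> x _; rewrite lee_fin indicE; case: (boolP (x \in _)).
    by rewrite inE /= mulr1.
  by rewrite mulr0.
Qed.

End bounded_measurable_theory.

(** * Independence and Chebyshev's inequality *)

Section product_expectation.
Context d1 d2 (T1 : measurableType d1) (T2 : measurableType d2) (R : realType).
Variables (mu : probability T1 R) (nu : probability T2 R).

Lemma Rintegral_fubini (h : T1 * T2 -> R) : bounded_measurable h ->
  \int[(mu \x nu)%E]_z h z = \int[mu]_x \int[nu]_y h (x, y).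
Proof.
move=> hh; rewrite /Rintegral -integral12_prod_meas1/=; last first.
  exact: (bounded_measurable_integrable (mu \x nu)%E hh).
congr fine; apply: eq_integral => x _.
apply: integral_bounded_measurable.
exact: (bounded_measurable_comp hh (measurable_pair1 x)).
Qed.

Lemma Rintegral_prodM (f : T1 -> R) (g : T2 -> R) :
  bounded_measurable f -> bounded_measurable g ->
  \int[(mu \x nu)%E]_z (f z.1 * g z.2) = \int[mu]_x f x * \int[nu]_y g y.
Proof.
move=> hf hg; rewrite Rintegral_fubini; last first.
  apply: bounded_measurableM.
    exact: (bounded_measurable_comp hf measurable_fst).
  exact: (bounded_measurable_comp hg measurable_snd).
rewrite -RintegralZr//; last exact: bounded_measurable_integrable.
apply: eq_Rintegral => x _ /=; rewrite RintegralZl//.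
exact: bounded_measurable_integrable.
Qed.

End product_expectation.

Lemma Rintegral_distribution d (Omega : measurableType d) (R : realType)
    (P : probability Omega R) dX (X : measurableType dX) (Y : {RV P >-> X})
    (f : X -> R) : bounded_measurable f ->
  \int[distribution P Y]_x f x = \int[P]_w f (Y w).
Proof.
move=> hf; rewrite /Rintegral integral_distribution//.
  by apply/measurable_EFinP; exact: hf.1.
apply: bounded_measurable_integrable.
by apply: (bounded_measurable_comp hf); exact: measurable_funPT.
Qed.

Lemma eq_measure_Rintegral dX (X : measurableType dX) (R : realType)
    (mu nu : probability X R) (f : X -> R) :
  (forall A, measurable A -> mu A = nu A) ->
  \int[mu]_x f x = \int[nu]_x f x.
Proof.
by move=> E; congr fine; apply: eq_measure_integral => A mA _; exact: E.
Qed.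

Section independent_pair.
Context d (Omega : measurableType d) (R : realType) (P : probability Omega R).
Context dX (X : measurableType dX) (Y1 Y2 : {RV P >-> X}).
Hypothesis indep : forall A B, measurable A -> measurable B ->
  P (Y1 @^-1` A `&` Y2 @^-1` B) = (P (Y1 @^-1` A) * P (Y2 @^-1` B))%E.

(** Independence says that the law of the pair and the product of the marginal laws agree on
    rectangles; this determines the product measure. *)
Lemma Rintegral_independent_pair (h : X * X -> R) : bounded_measurable h ->
  \int[P]_w h (Y1 w, Y2 w) =
  \int[(distribution P Y1 \x distribution P Y2)%E]_z h z.
Proof.
move=> hh.
have mZ : measurable_fun [set: Omega] (fun w => (Y1 w, Y2 w)).
  by apply: measurable_fun_pair; exact: measurable_funPT.
pose Z : {mfun Omega >-> (X * X)%type} := mfun_Sub (mem_set mZ).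
rewrite -[LHS](Rintegral_distribution (Z : {RV P >-> (X * X)%type}) hh).
apply: eq_measure_Rintegral => A mA.
by apply/esym/product_measure_unique => // B C mB mC; exact: indep.
Qed.

Lemma Rintegral_independentM (f g : X -> R) :
  bounded_measurable f -> bounded_measurable g ->
  \int[P]_w (f (Y1 w) * g (Y2 w)) = \int[P]_w f (Y1 w) * \int[P]_w g (Y2 w).
Proof.
move=> hf hg; rewrite -!Rintegral_distribution// -Rintegral_prodM//.
apply: (Rintegral_independent_pair (h := fun z => f z.1 * g z.2)).
apply: bounded_measurableM.
  exact: (bounded_measurable_comp hf measurable_fst).
exact: (bounded_measurable_comp hg measurable_snd).
Qed.

End independent_pair.

Section independent_sums.
Context d (Omega : measurableType d) (R : realType) (P : probability Omega R).
Context dX (X : measurableType dX) (n : nat) (Y : 'I_n -> {RV P >-> X}).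
Hypothesis indep : forall i j : 'I_n, i != j -> forall A B,
  measurable A -> measurable B ->
  P (Y i @^-1` A `&` Y j @^-1` B) = (P (Y i @^-1` A) * P (Y j @^-1` B))%E.
Context (f : X -> R) (B : R) (c : 'I_n -> R).
Hypothesis mf : measurable_fun [set: X] f.
Hypothesis fB : forall x, f x ^+ 2 <= B.

Let hf : bounded_measurable f.
Proof.
(* From [|z| <= 1 + z ^ 2]. *)
split=> //; exists (1 + B) => x; rewrite ler_norml.
by have := fB x; rewrite expr2 => h; apply/andP; split; nra.
Qed.

Let hfY i : bounded_measurable (fun w => f (Y i w)).
Proof. by apply: (bounded_measurable_comp hf); exact: measurable_funPT. Qed.

Let mean i := \int[P]_w f (Y i w).
Let u i w := f (Y i w) - mean i.

Let hu i : bounded_measurable (u i).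
Proof. exact: (bounded_measurableB (hfY i) (bounded_measurable_cst _ _)). Qed.

Let centered i j : i != j -> \int[P]_w (u i w * u j w) = 0.
Proof.
move=> ij.
have hg k : bounded_measurable (fun x => f x - mean k).
  exact: (bounded_measurableB hf (bounded_measurable_cst _ _)).
rewrite (Rintegral_independentM (indep ij) (hg i) (hg j)).
rewrite RintegralB//; last 2 first.
- exact: bounded_measurable_integrable.
- exact: (bounded_measurable_integrable _ (bounded_measurable_cst _ _)).
by rewrite Rintegral_prob_cst subrr mul0r.
Qed.

(** A variance is at most the raw second moment. *)
Let square_le i : \int[P]_w (u i w * u i w) <= B.
Proof.
have -> : \int[P]_w (u i w * u i w) =
    \int[P]_w (f (Y i w) * f (Y i w)) - mean i ^+ 2.
  have -> : \int[P]_w (u i w * u i w) =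
    \int[P]_w (f (Y i w) * f (Y i w) - (2 * mean i * f (Y i w) - mean i ^+ 2)).
    by apply: eq_Rintegral => w _; rewrite /u; ring.
  have h2 : bounded_measurable (fun w => 2 * mean i * f (Y i w)).
    exact: (bounded_measurableM (bounded_measurable_cst _ _) (hfY i)).
  rewrite RintegralB//; last 2 first.
  - exact/bounded_measurable_integrable/(bounded_measurableM (hfY i)).
  - apply: bounded_measurable_integrable.
    exact: (bounded_measurableB h2 (bounded_measurable_cst _ _)).
  rewrite RintegralB//; last 2 first.
  - exact: bounded_measurable_integrable.
  - exact: (bounded_measurable_integrable _ (bounded_measurable_cst _ _)).
  rewrite RintegralZl//; last exact: bounded_measurable_integrable.
  by rewrite Rintegral_prob_cst -/(mean i); ring.
apply: (@le_trans _ _ (\int[P]_w (f (Y i w) * f (Y i w)))).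
  by rewrite lerBlDr lerDl sqr_ge0.
rewrite -[leRHS](Rintegral_prob_cst P); apply: Rintegral_le.
- exact: (bounded_measurableM (hfY i)).
- exact: bounded_measurable_cst.
- by move=> w; rewrite -expr2.
Qed.

Let second_moment : \int[P]_w (\sum_i c i * u i w) ^+ 2 <= (\sum_i c i ^+ 2) * B.
Proof.
have hcu i j : bounded_measurable (fun w => c i * c j * (u i w * u j w)).
  by apply: (bounded_measurableM (bounded_measurable_cst _ _));
    exact: (bounded_measurableM (hu i) (hu j)).
have -> : \int[P]_w (\sum_i c i * u i w) ^+ 2 =
    \sum_i \sum_j c i * c j * \int[P]_w (u i w * u j w).
  have -> : \int[P]_w (\sum_i c i * u i w) ^+ 2 =
      \int[P]_w (\sum_i \sum_j c i * c j * (u i w * u j w)).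
    apply: eq_Rintegral => w _; rewrite expr2 mulr_suml; apply: eq_bigr => i _.
    by rewrite mulr_sumr; apply: eq_bigr => j _; ring.
  rewrite Rintegral_sum; last by move=> i; exact: bounded_measurable_sum.
  apply: eq_bigr => i _; rewrite Rintegral_sum//; apply: eq_bigr => j _.
  rewrite RintegralZl//; apply: bounded_measurable_integrable.
  exact: (bounded_measurableM (hu i) (hu j)).
rewrite mulr_suml; apply: ler_sum => i _.
rewrite (bigD1 i)//= big1 ?addr0; last first.
  by move=> j ji; rewrite centered ?mulr0// eq_sym.
by rewrite -expr2; apply: ler_wpM2l; [exact: sqr_ge0|exact: square_le].
Qed.

(** Pairwise independence kills the off-diagonal covariances, so the variance of the sum is at most
    [B] times the sum of the squared weights; Markov's inequality is applied to the square. *)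
Lemma weighted_sum_chebyshev (eps : R) : 0 < eps ->
  (P [set w | (eps <=
     `|\sum_i c i * f (Y i w) - \sum_i c i * \int[P]_w f (Y i w)|)%R] <=
  ((\sum_i c i ^+ 2) * B / eps ^+ 2)%:E)%E.
Proof.
move=> e0.
have hZ : bounded_measurable (fun w => (\sum_i c i * u i w) ^+ 2).
  under eq_fun do rewrite expr2.
  by apply: bounded_measurableM; apply: bounded_measurable_sum => i;
    exact: (bounded_measurableM (bounded_measurable_cst _ _) (hu i)).
have e20 : 0 < eps ^+ 2 by rewrite exprn_gt0.
have := Rintegral_markov P hZ (fun w => sqr_ge0 _) e20.
have -> : [set w | eps ^+ 2 <= (\sum_i c i * u i w) ^+ 2] =
  [set w | eps <= `|\sum_i c i * f (Y i w) - \sum_i c i * \int[P]_w f (Y i w)|].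
  apply/funext => w /=; congr (is_true _).
  have -> : \sum_i c i * f (Y i w) - \sum_i c i * \int[P]_w f (Y i w) =
      \sum_i c i * u i w by rewrite -sumrB; apply: eq_bigr => i _; rewrite -mulrBr.
  by rewrite -[X in _ <= X]real_normK ?num_real// ler_sqr ?nnegrE// ltW.
move=> /le_trans; apply; rewrite lee_fin ler_pM2r ?invr_gt0//.
Qed.

End independent_sums.

(** * Features and truncation *)

Lemma hilbert_norm_ge0 (R : realType) (u : nat -> R) : (0 <= hilbert_norm u)%E.
Proof. exact: Lnorm_ge0. Qed.

(** Stated in the extended reals, so that it also covers sequences of infinite norm. *)
Lemma hilbert_norm_sqr (R : realType) (u : nat -> R) :
  (hilbert_norm u ^+ 2 = \sum_(l <oo) (u l ^+ 2)%:E)%E.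
Proof.
have s0 : (0 <= \sum_(l <oo) (u l ^+ 2)%:E)%E.
  by apply: nneseries_ge0 => l _ _; rewrite lee_fin sqr_ge0.
rewrite /hilbert_norm Lnorm_counting//.
rewrite (_ : (\sum_(l <oo) _)%E = (\sum_(l <oo) (u l ^+ 2)%:E)%E).
  by rewrite poweR12_sqrt// sqr_sqrte.
apply: eq_eseriesr => l _ /=.
by rewrite powR_mulrn// real_normK// num_real.
Qed.

Section truncated_features.
Context dX (X : measurableType dX) (R : realType).
Context (k : X -> X -> R) (phi : nat -> X -> R) (M : R).
Hypothesis mphi : forall l, measurable_fun [set: X] (phi l).
Hypothesis phiE : forall y y',
  (fun N => \sum_(0 <= l < N) phi l y * phi l y') @ \oo --> k y y'.

(* Truncating to the points where [k y y <= M ^+ 2], a set of full measure for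
   the laws of the observations, makes all features bounded everywhere. *)
Definition trunc_feature l y : R := if k y y <= M ^+ 2 then phi l y else 0.

Definition trunc_kernel y y' : R :=
  if (k y y <= M ^+ 2) && (k y' y' <= M ^+ 2) then k y y' else 0.

Lemma measurable_kernel_diag : measurable_fun [set: X] (fun y => k y y).
Proof.
apply: (measurable_fun_cvg (h := fun N y => \sum_(0 <= l < N) phi l y * phi l y)).
  by move=> N; apply: measurable_sum => l; exact: measurable_funM.
by move=> y _; exact: phiE.
Qed.

Lemma measurable_trunc_feature l : measurable_fun [set: X] (trunc_feature l).
Proof.
apply: measurable_fun_ifT => //.
by apply: measurable_fun_ler => //; exact: measurable_kernel_diag.
Qed.

(** Truncation multiplies every feature by the same indicator, so the truncated kernel has an
    expansion of the same form and inherits all the results on quadratic forms. *)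
Lemma trunc_kernel_expansion y y' :
  (fun N => \sum_(0 <= l < N) trunc_feature l y * trunc_feature l y') @ \oo
    --> trunc_kernel y y'.
Proof.
rewrite /trunc_kernel /trunc_feature.
case: (k y y <= M ^+ 2); case: (k y' y' <= M ^+ 2) => /=; first exact: phiE.
- by under eq_fun do under eq_bigr do rewrite mulr0; under eq_fun do rewrite big1_eq;
    exact: cvg_cst.
- by under eq_fun do under eq_bigr do rewrite mul0r; under eq_fun do rewrite big1_eq;
    exact: cvg_cst.
- by under eq_fun do under eq_bigr do rewrite mul0r; under eq_fun do rewrite big1_eq;
    exact: cvg_cst.
Qed.

Lemma trunc_kernel_diag_le y : trunc_kernel y y <= M ^+ 2.
Proof.
by rewrite /trunc_kernel andbb; case: ifPn => // _; exact: sqr_ge0.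
Qed.

Lemma trunc_kernel_diag_ge0 y : 0 <= trunc_kernel y y.
Proof. exact: (kernel_diag_ge0 trunc_kernel_expansion). Qed.

Lemma trunc_kernel_le y y' : `|trunc_kernel y y'| <= M ^+ 2.
Proof.
exact: (kernel_le trunc_kernel_expansion) (trunc_kernel_diag_le y)
  (trunc_kernel_diag_le y').
Qed.

Lemma partial_trunc_le y y' N :
  `|\sum_(0 <= l < N) trunc_feature l y * trunc_feature l y'| <= M ^+ 2.
Proof.
exact: (partial_kernel_le trunc_kernel_expansion) (trunc_kernel_diag_le y)
  (trunc_kernel_diag_le y').
Qed.

Lemma partial_trunc_sqr_le y N :
  \sum_(0 <= l < N) trunc_feature l y ^+ 2 <= M ^+ 2.
Proof.
exact: le_trans (partial_norm_le trunc_kernel_expansion y N)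
  (trunc_kernel_diag_le y).
Qed.

Lemma trunc_feature_bounded l : bounded_measurable (trunc_feature l).
Proof.
split; first exact: measurable_trunc_feature.
exists (1 + M ^+ 2) => y; have := partial_trunc_sqr_le y l.+1.
rewrite big_nat_recr//=.
have : 0 <= \sum_(0 <= i < l) trunc_feature i y ^+ 2.
  by apply: sumr_ge0 => i _; exact: sqr_ge0.
move: (trunc_feature l y) (M ^+ 2) => x B h1; rewrite expr2 => h2.
by rewrite ler_norml; apply/andP; split; nra.
Qed.

Lemma trunc_kernel_bounded :
  bounded_measurable (fun z : X * X => trunc_kernel z.1 z.2).
Proof.
split; last by exists (M ^+ 2) => z; exact: trunc_kernel_le.
apply: (measurable_fun_cvg (h := fun N z =>
  \sum_(0 <= l < N) trunc_feature l z.1 * trunc_feature l z.2)).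
  move=> N; apply: measurable_sum => l; apply: measurable_funM.
    exact: (measurableT_comp (measurable_trunc_feature l) measurable_fst).
  exact: (measurableT_comp (measurable_trunc_feature l) measurable_snd).
by move=> z _; exact: trunc_kernel_expansion.
Qed.

(** The mean of the kernel under a product law is the scalar product of the two mean features. Sum
    and integral are exchanged by dominated convergence, the partial sums being bounded by
    [M ^ 2]. *)
Lemma trunc_kernel_mean_cvg (mu nu : probability X R) :
  (fun N => \sum_(0 <= l < N)
     \int[mu]_y trunc_feature l y * \int[nu]_y trunc_feature l y) @ \oo -->
  \int[(mu \x nu)%E]_z trunc_kernel z.1 z.2.
Proof.
have hf l : bounded_measurable
    (fun z : X * X => trunc_feature l z.1 * trunc_feature l z.2).
  apply: bounded_measurableM.
    exact: (bounded_measurable_comp (trunc_feature_bounded l) measurable_fst).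
  exact: (bounded_measurable_comp (trunc_feature_bounded l) measurable_snd).
have -> : (fun N => \sum_(0 <= l < N)
     \int[mu]_y trunc_feature l y * \int[nu]_y trunc_feature l y) =
  (fun N => \int[(mu \x nu)%E]_z
     \sum_(0 <= l < N) trunc_feature l z.1 * trunc_feature l z.2).
  apply/funext => N; rewrite (Rintegral_sum (mu \x nu)%E _ hf).
  apply: eq_bigr => l _; apply/esym.
  exact: (Rintegral_prodM mu nu (trunc_feature_bounded l) (trunc_feature_bounded l)).
apply: (Rintegral_dominated_cvg (P := (mu \x nu)%E) (B := M ^+ 2)
  (f_ := fun N z => \sum_(0 <= l < N) trunc_feature l z.1 * trunc_feature l z.2)
  (f := fun z => trunc_kernel z.1 z.2)).
- move=> N; apply: (bounded_measurable_sum _ hf).1.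
- by move=> N z; exact: partial_trunc_le.
- by move=> z; exact: trunc_kernel_expansion.
Qed.

Context (mu : probability X R).
Hypothesis mu_good : {ae mu, forall y, k y y <= M ^+ 2}.

Lemma feature_mean_trunc l : \int[mu]_y phi l y = \int[mu]_y trunc_feature l y.
Proof.
congr fine; apply: ae_eq_integral => //.
- exact/measurable_EFinP.
- exact/measurable_EFinP/measurable_trunc_feature.
- by apply: filterS mu_good => y hy _; rewrite /= /trunc_feature hy.
Qed.

Lemma kernel_diag_trunc :
  (\int[mu]_y (k y y)%:E = (\int[mu]_y trunc_kernel y y)%:E)%E.
Proof.
have hb : bounded_measurable (fun y => trunc_kernel y y).
  apply: (bounded_measurable_comp trunc_kernel_bounded (g := fun y => (y, y))).
  exact: measurable_fun_pair.
rewrite -integral_bounded_measurable//; apply: ae_eq_integral => //.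
- exact/measurable_EFinP/measurable_kernel_diag.
- by apply/measurable_EFinP; case: hb.
- by apply: filterS mu_good => y hy _; rewrite /= /trunc_kernel hy.
Qed.

(** The double integral of the truncated kernel against [mu] is zero by centering, and is also the
    sum of the squares of the coordinate means; hence each of them vanishes. *)
Lemma centered_feature_mean0 :
  (forall y, \int[mu]_z k y z = 0) ->
  forall l, \int[mu]_y trunc_feature l y = 0.
Proof.
move=> kc l.
have mk y : measurable_fun [set: X] (k y).
  apply: (measurable_fun_cvg (h := fun N z => \sum_(0 <= l < N) phi l y * phi l z)).
    by move=> N; apply: measurable_sum => i; exact: measurable_funM.
  by move=> z _; exact: phiE.
have I0 : \int[(mu \x mu)%E]_z trunc_kernel z.1 z.2 = 0.
  rewrite Rintegral_fubini; last exact: trunc_kernel_bounded.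
  rewrite -[RHS](Rintegral_prob_cst mu); apply: eq_Rintegral => y _ /=.
  have [hy|hy] := boolP (k y y <= M ^+ 2); last first.
    rewrite -[RHS](Rintegral_prob_cst mu); apply: eq_Rintegral => z _.
    by rewrite /trunc_kernel (negbTE hy).
  rewrite -(kc y); congr fine; apply: ae_eq_integral => //.
  - apply/measurable_EFinP.
    by have [] := bounded_measurable_comp trunc_kernel_bounded (measurable_pair1 y).
  - exact/measurable_EFinP.
  - by apply: filterS mu_good => z hz _; rewrite /= /trunc_kernel hy hz.
have := @trunc_kernel_mean_cvg mu mu; rewrite I0 => cv.
have nd : nondecreasing_seq (fun N => \sum_(0 <= l < N)
     \int[mu]_y trunc_feature l y * \int[mu]_y trunc_feature l y).
  by apply/nondecreasing_seqP => m; rewrite big_nat_recr//= lerDl -expr2 sqr_ge0.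
have := nondecreasing_cvgn_le nd (cvgP _ cv) l.+1; rewrite (cvg_lim _ cv)//.
rewrite big_nat_recr//= => h; apply/eqP; rewrite -sqrf_eq0 eq_le sqr_ge0 andbT.
rewrite expr2; apply: le_trans h; rewrite lerDr.
by apply: sumr_ge0 => i _; rewrite -expr2 sqr_ge0.
Qed.

End truncated_features.

(** * The centered kernel of a semi-metric *)

Section centered_kernel_theory.
Context dX (X : measurableType dX) (R : realType) (d : X -> X -> R).
Hypothesis hd : negative_type_semimetric d.
Context (F0 : probability X R) (y0 : X).

Let base := base_kernel d y0.

Let base_sym y y' : base y y' = base y' y.
Proof.
by rewrite /base /base_kernel (semimetric_sym hd y y') [d y y0 + _]addrC.
Qed.

Let g y := \int[F0]_z base y z.

Let centeredE y y' : centered_kernel d F0 y0 y y' =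
  base y y' - g y - g y' + \int[(F0 \x F0)%E]_p base p.1 p.2.
Proof.
rewrite /centered_kernel -/base -/(g y); congr (_ - _ + _).
by apply: eq_Rintegral => z _; exact: base_sym.
Qed.

(** The centering terms cancel in this combination, and so do the distances to [y0]; what remains is
    [d y y'] because [d] vanishes on the diagonal. *)
Lemma semimetric_kernel y y' : d y y' =
  centered_kernel d F0 y0 y y + centered_kernel d F0 y0 y' y'
  - 2 * centered_kernel d F0 y0 y y'.
Proof.
rewrite !centeredE /base /base_kernel.
have d0 z : d z z = 0 by apply/(semimetric_eq0 hd).
by rewrite !d0; field.
Qed.

(** Integrability lets Fubini identify the mean of [g] with the double integral [c], after which all
    terms cancel. *)
Lemma centered_kernel_mean0 y : base_kernel_integrable d F0 y0 ->
  \int[F0]_z centered_kernel d F0 y0 y z = 0.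
Proof.
move=> [hk1 hk2].
pose c := \int[(F0 \x F0)%E]_p base p.1 p.2.
have gE z : fubini_F F0 (fun p : X * X => (base p.1 p.2)%:E) z = (g z)%:E.
  by rewrite /fubini_F /g /Rintegral fineK//; exact: (integrable_fin_num _ (hk1 z)).
have ig : F0.-integrable setT (EFin \o g).
  have := integrable_fubini_F hk2; exact: eq_integrable.
have cE : \int[F0]_z g z = c.
  rewrite /c /Rintegral -(integral12_prod_meas1 hk2); congr fine.
  by apply: eq_integral => z _; rewrite gE.
have icst (a : R) : F0.-integrable setT (EFin \o cst a).
  exact: (bounded_measurable_integrable F0 (bounded_measurable_cst _ a)).
transitivity (\int[F0]_z ((base y z - g z) - (g y - c))).
  by apply: eq_Rintegral => z _; rewrite centeredE -/c; ring.
have ibg : F0.-integrable setT (EFin \o (fun z => base y z - g z)).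
  exact: (integrableB measurableT (hk1 y) ig).
rewrite RintegralB//; last exact: icst.
rewrite RintegralB//; last exact: (hk1 y).
by rewrite cE Rintegral_prob_cst -/(g y); ring.
Qed.

End centered_kernel_theory.

(** * Finite-sample power bounds *)

Lemma mutually_independent_pair d (Omega : measurableType d) (R : realType)
    (P : probability Omega R) dX (X : measurableType dX) (n : nat)
    (Y : 'I_n -> {RV P >-> X}) :
  mutually_independent P (fun i => g_sigma_algebra_preimage (Y i)) ->
  forall i j : 'I_n, i != j -> forall A B, measurable A -> measurable B ->
  P (Y i @^-1` A `&` Y j @^-1` B) = (P (Y i @^-1` A) * P (Y j @^-1` B))%E.
Proof.
move=> ind i j ij A B mA mB.
pose E l := if l == i then Y i @^-1` A else Y j @^-1` B.
have Ei : E i = Y i @^-1` A by rewrite /E eqxx.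
have Ej : E j = Y j @^-1` B by rewrite /E eq_sym (negbTE ij).
rewrite -Ei -Ej; have := ind [:: i; j] E; rewrite !big_cons !big_nil setIT mule1.
apply; first by rewrite /= inE ij.
move=> l; rewrite !inE => /orP[] /eqP ->.
  by rewrite Ei; exists A => //; rewrite setTI.
by rewrite Ej; exists B => //; rewrite setTI.
Qed.

Section power_bounds.
Context dX (X : measurableType dX) (R : realType) (d : X -> X -> R).
Context (k : X -> X -> R) (phi : nat -> X -> R) (M : R).
Hypothesis dk : forall y y', d y y' = k y y + k y' y' - 2 * k y y'.
Hypothesis mphi : forall l, measurable_fun [set: X] (phi l).
Hypothesis phiE : forall y y',
  (fun N => \sum_(0 <= l < N) phi l y * phi l y') @ \oo --> k y y'.
Context dO (Omega : measurableType dO) (P : probability Omega R).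
Context (n t : nat) (Y : 'I_n -> {RV P >-> X}) (F0 F1 : probability X R).
Hypothesis indep : forall i j : 'I_n, i != j -> forall A B,
  measurable A -> measurable B ->
  P (Y i @^-1` A `&` Y j @^-1` B) = (P (Y i @^-1` A) * P (Y j @^-1` B))%E.
Hypothesis law0 : forall (i : 'I_n) A, (i < t)%N -> measurable A ->
  distribution P (Y i) A = F0 A.
Hypothesis law1 : forall (i : 'I_n) A, (t <= i)%N -> measurable A ->
  distribution P (Y i) A = F1 A.
Hypothesis good : forall i, {ae P, forall w, k (Y i w) (Y i w) <= M ^+ 2}.
Hypothesis t1 : (1 < t)%N.
Hypothesis tn : (t.+1 < n)%N.

Let s : R := n%:R - t%:R.
Let tn' : (t <= n)%N. Proof. by rewrite ltnW// ltnW. Qed.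
Let t_gt0 : 0 < t%:R :> R. Proof. by rewrite ltr0n ltnW. Qed.
Let s_gt0 : 0 < s. Proof. by rewrite subr_gt0 ltr_nat ltnW. Qed.

Let law_good i (F : probability X R) :
  (forall A, measurable A -> distribution P (Y i) A = F A) ->
  {ae F, forall x, k x x <= M ^+ 2}.
Proof.
move=> lawF; have mA : measurable (~` [set x | k x x <= M ^+ 2]).
  apply: measurableC.
  have := measurable_set_ge (- M ^+ 2)
    (measurable_funN (measurable_kernel_diag mphi phiE)).
  by congr measurable; apply/seteqP; split => x /=; rewrite lerN2.
have PA : P (Y i @^-1` (~` [set x | k x x <= M ^+ 2])) = 0%E.
  apply/negligibleP; last exact: good.
  by rewrite -[X in measurable X]setTI; exact: measurable_funPT.
by apply/negligibleP => //; exact: etrans (esym (lawF _ mA)) PA.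
Qed.

(** [F0] is the law of the observation of index 0 and [F1] that of the observation of index [t], so
    the almost sure bound on the observations passes to both laws. *)
Lemma law0_good : {ae F0, forall x, k x x <= M ^+ 2}.
Proof.
have h : (0 < n)%N by exact: leq_trans (ltnW t1) tn'.
by apply: (@law_good (Ordinal h)) => A mA; rewrite law0//= ltnW.
Qed.

Lemma law1_good : {ae F1, forall x, k x x <= M ^+ 2}.
Proof. by apply: (@law_good (Ordinal (ltnW tn))) => A mA; rewrite law1. Qed.

(** With these weights a sum over the sample is the difference of the two block means. *)
Let weight (i : 'I_n) : R := if (i < t)%N then t%:R^-1 else - s^-1.

Let weight0 (i : 'I_n) : (i < t)%N -> weight i = t%:R^-1.
Proof. by rewrite /weight => ->. Qed.

Let weight1 (i : 'I_n) : (t <= i)%N -> weight i = - s^-1.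
Proof. by rewrite /weight leqNgt => /negbTE ->. Qed.

Let sum_weight_sqr : \sum_i weight i ^+ 2 = t%:R^-1 + s^-1.
Proof.
rewrite (sum_ord_split t).
under eq_bigr do rewrite weight0//.
under [X in _ + X]eq_bigr do rewrite weight1//.
rewrite sum_ord_lt_const// sum_ord_ge_const// -/s.
by field; rewrite !gt_eqF.
Qed.

Let sum_weight (g : 'I_n -> R) : \sum_i weight i * g i =
  (\sum_(i < n | (i < t)%N) g i) / t%:R - (\sum_(i < n | (t <= i)%N) g i) / s.
Proof.
rewrite (sum_ord_split t) mulrC [X in _ - X]mulrC !mulr_sumr -sumrN.
congr (_ + _); apply: eq_bigr => i ?; first by rewrite weight0.
by rewrite weight1// mulNr.
Qed.

Let mean0 f (i : 'I_n) : bounded_measurable f -> (i < t)%N ->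
  \int[P]_w f (Y i w) = \int[F0]_x f x.
Proof.
move=> hf it; rewrite -Rintegral_distribution//.
by apply: eq_measure_Rintegral => A mA; exact: law0.
Qed.

Let mean1 f (i : 'I_n) : bounded_measurable f -> (t <= i)%N ->
  \int[P]_w f (Y i w) = \int[F1]_x f x.
Proof.
move=> hf it; rewrite -Rintegral_distribution//.
by apply: eq_measure_Rintegral => A mA; exact: law1.
Qed.

Let two_sample_chebyshev f (B v eps : R) :
  bounded_measurable f -> (forall x, f x ^+ 2 <= B) ->
  v = \int[F0]_x f x - \int[F1]_x f x -> 0 < eps ->
  (P [set w | (eps <= `|\sum_i weight i * f (Y i w) - v|)%R] <=
   ((t%:R^-1 + s^-1) * B / eps ^+ 2)%:E)%E.
Proof.
move=> hf fB -> e0; rewrite -sum_weight_sqr.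
have := weighted_sum_chebyshev indep weight hf.1 fB e0.
suff -> : \sum_i weight i * \int[P]_w f (Y i w) =
  \int[F0]_x f x - \int[F1]_x f x by [].
rewrite sum_weight.
under eq_bigr do rewrite mean0//.
under [X in _ - X / _]eq_bigr do rewrite mean1//.
rewrite sum_ord_lt_const// sum_ord_ge_const// -/s.
by field; rewrite !gt_eqF.
Qed.

Let measurable_weighted f (v eps : R) : bounded_measurable f ->
  measurable [set w | (eps <= `|\sum_i weight i * f (Y i w) - v|)%R].
Proof.
move=> hf; apply: measurable_set_ge; apply: measurableT_comp => //.
apply: measurable_funB => //; apply: measurable_sum => i.
apply: measurable_funM => //.
exact: (measurableT_comp hf.1 (measurable_funPT (Y i))).
Qed.

Let kern w i j := k (Y i w) (Y j w).

Let dE w i j : d (Y i w) (Y j w) = kern w i i + kern w j j - 2 * kern w i j.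
Proof. exact: dk. Qed.

Let delta l := \int[F0]_x phi l x - \int[F1]_x phi l x.

(** [D] is the squared norm of the first [N] coordinates of [mu_0 - mu_1]. The scalar product [Z] of
    this truncation with the difference of the block means of the features has mean [D], and
    Chebyshev keeps it above [D / 2]. The event [E] is left abstract, so as to be the one on which
    the whole scan exceeds [q]. *)
Lemma T1_power (N : nat) (D q : R) (E : set Omega) :
  D = \sum_(0 <= l < N) delta l ^+ 2 -> 0 < D ->
  q < t%:R * s / n%:R * (D / 4) - 4 * M ^+ 2 ->
  measurable E ->
  (forall w, q < t%:R * s / n%:R * T1 d (fun i => Y i w) t -> E w) ->
  ((1 - (t%:R^-1 + s^-1) * (4 * M ^+ 2) / D)%:E <= P E)%E.
Proof.
move=> DE D0 qlt mE hE.
pose tf := trunc_feature k phi M.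
have btf l : bounded_measurable (tf l) := trunc_feature_bounded M mphi phiE l.
pose f x := \sum_(0 <= l < N) delta l * tf l x.
have bf : bounded_measurable f.
  apply: bounded_measurable_sum => l.
  exact: (bounded_measurableM (bounded_measurable_cst _ _) (btf l)).
have fB x : f x ^+ 2 <= D * M ^+ 2.
  apply: le_trans (finite_cauchy_schwarz _ _ _) _; rewrite -DE.
  by rewrite ler_pM2l//; exact: (partial_trunc_sqr_le M phiE).
have meanf (F : probability X R) : {ae F, forall x, k x x <= M ^+ 2} ->
    \int[F]_x f x = \sum_(0 <= l < N) delta l * \int[F]_x phi l x.
  move=> gF; rewrite Rintegral_sum; last first.
    by move=> l; exact: (bounded_measurableM (bounded_measurable_cst _ _) (btf l)).
  apply: eq_bigr => l _; rewrite RintegralZl//; last first.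
    exact: bounded_measurable_integrable.
  by rewrite (feature_mean_trunc mphi phiE gF).
have DM : D = \int[F0]_x f x - \int[F1]_x f x.
  rewrite (meanf _ law0_good) (meanf _ law1_good) -sumrB DE.
  by apply: eq_bigr => l _; rewrite -mulrBr.
have D20 : 0 < D / 2 by rewrite divr_gt0.
have cheb := two_sample_chebyshev bf fB DM D20.
(* The second moment bound is proportional to [D] and the squared deviation to [D ^ 2]: one factor
   [1 / D] is left. *)
have bad_le : (t%:R^-1 + s^-1) * (D * M ^+ 2) / (D / 2) ^+ 2 =
    (t%:R^-1 + s^-1) * (4 * M ^+ 2) / D.
  by field; rewrite !gt_eqF.
rewrite bad_le in cheb.
apply: (probability_ge_of_bad mE (measurable_weighted D (D / 2) bf) cheb).
have := @ae_ord_forall _ _ _ P n (fun i w => k (Y i w) (Y i w) <= M ^+ 2) good.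
apply: filterS => w gw /negP; rewrite -ltNge => Zclose; apply: hE.
set Z := \sum_i _ in Zclose.
have ZE : Z = \sum_(0 <= l < N) delta l * \sum_i weight i * phi l (Y i w).
  rewrite /Z; under [RHS]eq_bigr do rewrite mulr_sumr.
  rewrite exchange_big; apply: eq_bigr => i _; rewrite mulr_sumr.
  by apply: eq_bigr => l _; rewrite /tf /trunc_feature gw mulrCA.
have := kernel_form_cauchy_schwarz phiE (fun i => Y i w) weight delta N.
rewrite -ZE -DE (kernel_form_blocks phiE).
have ZD : D / 2 <= Z by move: Zclose; rewrite ltr_norml => /andP[? ?]; lra.
set K00 := \sum_(i < n | (i < t)%N) _; set K01 := \sum_(i < n | (i < t)%N) _.
set K11 := \sum_(i < n | _) _.
set Q := (X in D * X) => CS.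
(* Cauchy-Schwarz gives [D ^ 2 / 4 <= Z ^ 2 <= D Q], where [Q] is the squared norm of the difference
   of the block means. *)
have QD : D / 4 <= Q by rewrite -(ler_pM2l D0); apply: le_trans CS; nra.
have QE : Q = K00 / t%:R ^+ 2 + K11 / s ^+ 2 - 2 * K01 / (t%:R * s).
  by rewrite /Q; field; rewrite !gt_eqF.
have := T1_lower (dE w) gw (kernel_block0_ge0 phiE (fun i => Y i w) t)
  (kernel_block1_ge0 phiE (fun i => Y i w) t) t1 tn.
rewrite -/K00 -/K11 -/K01 -/s -QE; apply: lt_le_trans; apply: lt_le_trans qlt _.
rewrite lerD2r ler_wpM2l// mulr_ge0 ?invr_ge0 ?ler0n// mulr_ge0 ?ltW//.
Qed.


Let tk := trunc_kernel k M.

Let btk : bounded_measurable (fun z : X * X => tk z.1 z.2).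
Proof. exact: (trunc_kernel_bounded M mphi phiE). Qed.

Let btkY i j : bounded_measurable (fun w => tk (Y i w) (Y j w)).
Proof.
apply: (bounded_measurable_comp btk (g := fun w => (Y i w, Y j w))).
by apply: measurable_fun_pair; exact: measurable_funPT.
Qed.

(** By independence and zero feature means the off-diagonal terms have mean zero; only the diagonal
    contributes, at most [M ^ 2] per observation. *)
Let block_mean_le (p : pred 'I_n) (c : R) :
  (forall x : R, \sum_(i | p i) x = c * x) ->
  (forall i l, p i -> \int[P]_w trunc_feature k phi M l (Y i w) = 0) ->
  \int[P]_w (\sum_(i | p i) \sum_(j | p j) tk (Y i w) (Y j w)) <= c * M ^+ 2.
Proof.
move=> hc m0.
have -> : \int[P]_w (\sum_(i | p i) \sum_(j | p j) tk (Y i w) (Y j w)) =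
    \sum_(i | p i) \sum_(j | p j) \int[P]_w tk (Y i w) (Y j w).
  (* Filtering the index list turns the conditional sums into the unconditional ones of
     [Rintegral_sum]. *)
  rewrite -[RHS]big_filter; under [RHS]eq_bigr do rewrite -big_filter.
  under eq_Rintegral do rewrite -big_filter.
  under eq_Rintegral do under eq_bigr do rewrite -big_filter.
  rewrite Rintegral_sum; last by move=> i; exact: bounded_measurable_sum.
  by apply: eq_bigr => i _; rewrite Rintegral_sum.
rewrite -hc; apply: ler_sum => i pi.
rewrite (bigD1 i)//= big1 ?addr0.
  rewrite -[leRHS](Rintegral_prob_cst P); apply: Rintegral_le => //.
    exact: bounded_measurable_cst.
  by move=> w; exact: (trunc_kernel_diag_le k M).
move=> j /andP[pj ji].
have ij : i != j by rewrite eq_sym.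
rewrite (Rintegral_independent_pair (indep ij) btk).
have := trunc_kernel_mean_cvg (M := M) mphi phiE
  (mu := distribution P (Y i)) (nu := distribution P (Y j)).
have mean_i l : \int[distribution P (Y i)]_x trunc_feature k phi M l x = 0.
  by rewrite Rintegral_distribution ?m0//; exact: trunc_feature_bounded.
under eq_fun do under eq_bigr do rewrite mean_i mul0r.
under eq_fun do rewrite big1_eq.
by move=> /cvg_lim <- //; rewrite lim_cst.
Qed.

Let block_markov (p : pred 'I_n) (c L : R) :
  (forall x : R, \sum_(i | p i) x = c * x) -> 0 < c -> 0 < L ->
  (forall i l, p i -> \int[P]_w trunc_feature k phi M l (Y i w) = 0) ->
  (forall w, 0 <= \sum_(i | p i) \sum_(j | p j) tk (Y i w) (Y j w)) ->
  measurable [set w | L * c <= \sum_(i | p i) \sum_(j | p j) tk (Y i w) (Y j w)] /\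
  (P [set w | (L * c <= \sum_(i | p i) \sum_(j | p j) tk (Y i w) (Y j w))%R] <=
    (M ^+ 2 / L)%:E)%E.
Proof.
move=> hc c0 L0 m0 pos.
have hb : bounded_measurable
    (fun w => \sum_(i | p i) \sum_(j | p j) tk (Y i w) (Y j w)).
  under eq_fun do rewrite -big_filter.
  apply: bounded_measurable_sum => i.
  by under eq_fun do rewrite -big_filter; exact: bounded_measurable_sum.
split; first exact: (measurable_set_ge _ hb.1).
apply: le_trans (Rintegral_markov P hb pos (mulr_gt0 L0 c0)) _.
rewrite lee_fin ler_pdivrMr ?mulr_gt0//.
apply: le_trans (block_mean_le hc m0) _.
suff -> : M ^+ 2 / L * (L * c) = c * M ^+ 2 by [].
by field; rewrite gt_eqF.
Qed.

(** There are three bad events: the difference of the diagonal means misses [v] by at least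
    [|v| / 2] (Chebyshev), or one of the two block sums of the kernel reaches [L] times the block
    size (Markov, [M ^ 2 / L] each). Outside them the deterministic bounds for [T2] and [shat] apply
    almost surely. *)
Lemma T2_power (L m v q : R) (E : set Omega) :
  (forall l, \int[F0]_x trunc_feature k phi M l x = 0) ->
  (forall l, \int[F1]_x trunc_feature k phi M l x = 0) ->
  v = \int[F0]_x tk x x - \int[F1]_x tk x x ->
  0 < m -> m <= t%:R - 1 -> m <= s - 1 -> 0 < L -> 0 < M ->
  12 * (M ^+ 2 + L) < `|v| * m ->
  q < (8 * M ^+ 2)^-1 * Num.sqrt (t%:R * s / n%:R) * (`|v| / 2) ->
  measurable E ->
  (forall w, q < (2 * shat d (fun i => Y i w))^-1 *
     Num.sqrt (t%:R * s / n%:R) * T2 d (fun i => Y i w) t -> E w) ->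
  ((1 - ((t%:R^-1 + s^-1) * (4 * M ^+ 4) / v ^+ 2 + 2 * M ^+ 2 / L))%:E
    <= P E)%E.
Proof.
move=> z0 z1 vE m0 mt ms L0 M0 vlarge qlt mE hE.
have M20 : 0 < M ^+ 2 by rewrite exprn_gt0.
have v0 : 0 < `|v|.
  have : 0 < `|v| * m by apply: lt_trans vlarge; rewrite mulr_gt0// addr_gt0.
  by rewrite pmulr_lgt0.
have vn0 : v != 0 by rewrite -normr_gt0.
have bdiag : bounded_measurable (fun x => tk x x).
  apply: (bounded_measurable_comp btk (g := fun x => (x, x))).
  exact: measurable_fun_pair.
have diagB x : tk x x ^+ 2 <= M ^+ 4.
  have := trunc_kernel_diag_le k M x.
  have := trunc_kernel_diag_ge0 M phiE x; rewrite -/(tk x x).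
  have -> : M ^+ 4 = M ^+ 2 * M ^+ 2 by ring.
  by rewrite expr2; nra.
have tkE := @trunc_kernel_expansion _ _ _ _ _ M phiE.
have v20 : 0 < `|v| / 2 by rewrite divr_gt0.
have cheb := two_sample_chebyshev bdiag diagB vE v20.
have hc0 (x : R) : \sum_(i < n | (i < t)%N) x = t%:R * x.
  exact: sum_ord_lt_const.
have hc1 (x : R) : \sum_(i < n | (t <= i)%N) x = s * x.
  exact: sum_ord_ge_const.
have hm0 (i : 'I_n) l : (i < t)%N ->
    \int[P]_w trunc_feature k phi M l (Y i w) = 0.
  by move=> it; rewrite mean0//; exact: trunc_feature_bounded.
have hm1 (i : 'I_n) l : (t <= i)%N ->
    \int[P]_w trunc_feature k phi M l (Y i w) = 0.
  by move=> it; rewrite mean1//; exact: trunc_feature_bounded.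
have [mB2 PB2] := block_markov hc0 t_gt0 L0 hm0
  (fun w => kernel_block0_ge0 tkE (fun i => Y i w) t).
have [mB3 PB3] := block_markov hc1 s_gt0 L0 hm1
  (fun w => kernel_block1_ge0 tkE (fun i => Y i w) t).
have mB1 := measurable_weighted v (`|v| / 2) bdiag.
have bad := le_trans (measureU2 P (measurableU _ _ mB1 mB2) mB3)
  (leeD (le_trans (measureU2 P mB1 mB2) (leeD cheb PB2)) PB3).
have -> : (t%:R^-1 + s^-1) * (4 * M ^+ 4) / v ^+ 2 + 2 * M ^+ 2 / L =
   (t%:R^-1 + s^-1) * M ^+ 4 / (`|v| / 2) ^+ 2 + M ^+ 2 / L + M ^+ 2 / L.
  by rewrite expr_div_n real_normK ?num_real//; field; rewrite vn0 !gt_eqF.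
apply: (probability_ge_of_bad mE _ bad).
  exact: measurableU (measurableU _ _ mB1 mB2) mB3.
have := @ae_ord_forall _ _ _ P n (fun i w => k (Y i w) (Y i w) <= M ^+ 2) good.
apply: filterS => w gw nbad; apply: hE.
have tkk i j : tk (Y i w) (Y j w) = kern w i j.
  by rewrite /tk /trunc_kernel !gw.
have n1 : `|\sum_i weight i * tk (Y i w) (Y i w) - v| <= `|v| / 2.
  by rewrite leNgt; apply/negP => h; apply: nbad; left; left; exact: ltW.
have n2 : \sum_(i < n | (i < t)%N) \sum_(j < n | (j < t)%N) kern w i j <= L * t%:R.
  rewrite leNgt; apply/negP => h; apply: nbad; left; right; apply/ltW.
  by under eq_bigr do under eq_bigr do rewrite tkk.
have n3 : \sum_(i < n | (t <= i)%N) \sum_(j < n | (t <= j)%N) kern w i j <= L * s.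
  rewrite leNgt; apply/negP => h; apply: nbad; right; apply/ltW.
  by under eq_bigr do under eq_bigr do rewrite tkk.
move: n1; rewrite sum_weight.
under eq_bigr do rewrite tkk.
under [X in _ - X / _]eq_bigr do rewrite tkk.
move=> n1.
have kb i j : `|kern w i j| <= M ^+ 2 by exact: (kernel_le phiE).
have kd i : 0 <= kern w i i by exact: (kernel_diag_ge0 phiE).
have b0 := kernel_block0_ge0 phiE (fun i => Y i w) t.
have b1 := kernel_block1_ge0 phiE (fun i => Y i w) t.
have b01 := kernel_block01_le phiE (fun i => Y i w) t.
have ksym i j : kern w i j = kern w j i by exact: (kernel_sym phiE).
have T2l := T2_lower (dE w) t1 tn m0 mt ms kb kd b0 b1 n2 n3 n1 vlarge.
have sh0 := shat_gt0 (dE w) ksym t1 tn m0 mt ms b0 b1 b01 n2 n3 n1 vlarge.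
have shM := shat_le (dE w) t1 tn kb.
have c0 : 0 <= (8 * M ^+ 2)^-1 * Num.sqrt (t%:R * s / n%:R).
  by rewrite mulr_ge0 ?sqrtr_ge0// invr_ge0; lra.
(* The constant [8 M ^ 2] is twice the upper bound on [shat]; positivity of [shat] is what allows
   the inverses to be compared. *)
apply: lt_le_trans qlt (ler_pM c0 (ltW v20) _ T2l).
apply: ler_wpM2r; first exact: sqrtr_ge0.
by rewrite lef_pV2 ?posrE; lra.
Qed.

End power_bounds.

(** * Measurability and convergence *)

Section measurable_statistics.
Context dX (X : measurableType dX) (R : realType) (d : X -> X -> R).
Hypothesis hd : negative_type_semimetric d.
Context dO (Omega : measurableType dO) (P : probability Omega R).
Context (n : nat) (Y : 'I_n -> {RV P >-> X}).

Let md i j : measurable_fun [set: Omega] (fun w => d (Y i w) (Y j w)).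
Proof.
have mp : measurable_fun [set: Omega] (fun w => (Y i w, Y j w)).
  by apply: measurable_fun_pair; exact: measurable_funPT.
exact: (measurableT_comp (semimetric_measurable hd) mp).
Qed.

Let msum (I : Type) (r : seq I) (p : pred I) (h : I -> Omega -> R) :
  (forall i, measurable_fun [set: Omega] (h i)) ->
  measurable_fun [set: Omega] (fun w => \sum_(i <- r | p i) h i w).
Proof.
by move=> mh; under eq_fun do rewrite -big_filter; exact: measurable_sum.
Qed.

Let mscale (c : R) (h : Omega -> R) : measurable_fun [set: Omega] h ->
  measurable_fun [set: Omega] (fun w => c * h w).
Proof. by move=> mh; exact: measurable_funM. Qed.

Let mdbarB1 t : measurable_fun [set: Omega] (fun w => dbarB1 d (fun i => Y i w) t).
Proof. by apply: mscale; apply: msum => i; apply: msum => j. Qed.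

Let mdbarB2 t : measurable_fun [set: Omega] (fun w => dbarB2 d (fun i => Y i w) t).
Proof. by apply: mscale; apply: msum => i; apply: msum => j. Qed.

Let mdbarA t : measurable_fun [set: Omega] (fun w => dbarA d (fun i => Y i w) t).
Proof. by apply: mscale; apply: msum => i; apply: msum => j. Qed.

Let mT1 t : measurable_fun [set: Omega] (fun w => T1 d (fun i => Y i w) t).
Proof.
apply: measurable_funB; last exact: mscale.
by apply: measurable_funB; last exact: mscale.
Qed.

Let mT2 t : measurable_fun [set: Omega] (fun w => T2 d (fun i => Y i w) t).
Proof. by apply: measurableT_comp => //; exact: measurable_funB. Qed.

Let mshat : measurable_fun [set: Omega] (fun w => shat d (fun i => Y i w)).
Proof.
have msqrt : measurable_fun [set: R] (@Num.sqrt R).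
  by apply: continuous_measurable_fun; exact: sqrt_continuous.
apply: (measurableT_comp msqrt); apply: measurable_funB.
  apply: mscale; apply: msum => i; apply: measurable_funX.
  by apply: mscale; apply: msum => j.
by apply: measurable_funX; apply: mscale; apply: msum => i; apply: msum => j.
Qed.

Let mscan_max rho0 rho1 (f : Omega -> nat -> R) :
  (forall t, measurable_fun [set: Omega] (f^~ t)) ->
  measurable_fun [set: Omega] (fun w => scan_max n rho0 rho1 (f w)).
Proof.
move=> mf; rewrite /scan_max; elim: (index_iota _ _) => [|t r IH].
  by under eq_fun do rewrite big_nil; exact: mf.
by under eq_fun do rewrite big_cons; exact: measurable_maxr.
Qed.

Lemma measurable_S1 rho0 rho1 :
  measurable_fun [set: Omega] (fun w => S1 d (fun i => Y i w) rho0 rho1).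
Proof. by apply: mscan_max => t; exact: mscale. Qed.

Lemma measurable_S2 rho0 rho1 :
  measurable_fun [set: Omega] (fun w => S2 d (fun i => Y i w) rho0 rho1).
Proof.
apply: mscan_max => t; apply: measurable_funM => //.
apply: measurable_funM => //.
(* Inversion is discontinuous at 0; on nonnegative reals, 0 included, it agrees with the power of
   exponent -1, which is measurable. *)
under eq_fun => w do rewrite -powR_inv1 ?mulr_ge0 ?sqrtr_ge0//.
by apply: (measurableT_comp (measurable_powR _)); exact: mscale.
Qed.

End measurable_statistics.

(** * The scan range, convergence of probabilities to one, and finite truncation of the norm *)

Lemma scan_max_ge (R : realType) (n t : nat) (rho0 rho1 : R) (f : nat -> R) :
  (nceil n rho0 <= t)%N -> (t <= nceil n rho1)%N -> f t <= scan_max n rho0 rho1 f.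
Proof. by move=> h0 h1; apply: le_bigmax_seq; rewrite ?mem_index_iota ?h0. Qed.

Lemma nceil_itv (R : realType) (n : nat) (rho : R) : 0 <= rho ->
  n%:R * rho <= (nceil n rho)%:R < n%:R * rho + 1.
Proof.
move=> r0; have x0 : 0 <= n%:R * rho by rewrite mulr_ge0.
have /andP[h1 h2] := ceil_itv (n%:R * rho).
have c0 : (0 <= Num.ceil (n%:R * rho))%R.
  by rewrite -(ler_int R); exact: le_trans x0 h2.
have -> : (nceil n rho)%:R = (Num.ceil (n%:R * rho))%:~R :> R.
  by rewrite /nceil -[in RHS](gez0_abs c0).
by rewrite h2 /= -ltrBlDr; move: h1; rewrite intrB.
Qed.

Lemma le_nceil (R : realType) (n : nat) (rho rho' : R) : 0 <= rho -> rho <= rho' ->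
  (nceil n rho <= nceil n rho')%N.
Proof.
move=> r0 rr; have x0 : 0 <= n%:R * rho by rewrite mulr_ge0.
have c0 (r : R) : 0 <= r -> (0 <= Num.ceil (n%:R * r))%R.
  move=> r'0; rewrite -(ler_int R).
  by have /andP[_] := ceil_itv (n%:R * r); apply: le_trans; rewrite mulr_ge0.
rewrite -lez_nat /nceil !gez0_abs ?c0//; last exact: le_trans rr.
by apply: le_ceil; rewrite ler_wpM2l.
Qed.

Lemma probability_cvg1 (R : realType) (p : nat -> \bar R) :
  (forall n, (p n <= 1)%E) ->
  (forall eps : R, 0 < eps -> \forall n \near \oo, ((1 - eps)%:E <= p n)%E) ->
  p @ \oo --> 1%E.
Proof.
move=> p1 hp; apply/fine_cvgP; split.
  near=> n; rewrite fin_numElt; apply/andP; split.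
    apply: (@lt_le_trans _ _ ((1 - 1)%:E)%E); first exact: ltNyr.
    by near: n; exact: hp.
  exact: le_lt_trans (p1 n) (ltry _).
apply/cvgrPdist_le => eps e0; near=> n.
have h : ((1 - eps)%:E <= p n)%E by near: n; exact: hp.
rewrite /=; move: h (p1 n); case: (p n) => [r| |]//=; rewrite !lee_fin => h1 h2.
by rewrite ler_norml; apply/andP; split; lra.
Unshelve. all: by end_near. Qed.

(** If all partial sums stayed below [A], so would the squared norm times [n], which is at least
    [(A + 1) ^ 2 > A]. Asking for [A + 1] avoids a square root, and an infinite norm is covered as
    well. *)
Lemma hilbert_norm_partial (R : realType) (u : nat -> R) (n : nat) (A : R) :
  0 <= A -> ((A + 1)%:E <= (Num.sqrt n%:R)%:E * hilbert_norm u)%E ->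
  exists N, A <= n%:R * \sum_(0 <= l < N) u l ^+ 2.
Proof.
move=> A0 hA; apply: contrapT => /forallNP hN.
have hN' N : n%:R * \sum_(0 <= l < N) u l ^+ 2 <= A.
  by apply/ltW; rewrite ltNge; apply/negP; exact: hN.
suff : (((A + 1) ^+ 2)%:E <= A%:E :> \bar R)%E.
  by rewrite lee_fin expr2; apply/negP; rewrite -ltNge; nra.
apply: (@le_trans _ _ (((Num.sqrt n%:R)%:E * hilbert_norm u) ^+ 2)%E).
  rewrite EFin_expe lee_sqr//; first by rewrite lee_fin; lra.
  by apply: mule_ge0; [rewrite lee_fin sqrtr_ge0|exact: hilbert_norm_ge0].
rewrite expe2 muleACA -!expe2 -EFin_expe sqr_sqrtr ?ler0n// hilbert_norm_sqr.
rewrite -nneseriesZl//; last by move=> i _; rewrite lee_fin sqr_ge0.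
apply: lime_le.
  apply: is_cvg_nneseries => i _ _.
  by rewrite -EFinM lee_fin mulr_ge0 ?sqr_ge0.
apply: nearW => N.
under eq_bigr do rewrite -EFinM.
by rewrite sumEFin lee_fin -mulr_sumr.
Qed.

(** * Consistency *)

Lemma change_point_interior (R : realType) (rho : R) : 0 < rho -> rho < 1 ->
  exists2 c : R, 0 < c & forall n : nat, 4 <= c * n%:R ->
    [/\ (1 < nceil n rho)%N, ((nceil n rho).+1 < n)%N,
        c * n%:R <= (nceil n rho)%:R & c * n%:R <= n%:R - (nceil n rho)%:R].
Proof.
move=> r0 r1; exists (Num.min rho ((1 - rho) / 2)).
  by rewrite lt_min r0 divr_gt0// subr_gt0.
move=> n; set c := Num.min _ _ => cn.
have c1 : c <= rho by rewrite ge_min lexx.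
have c2 : c <= (1 - rho) / 2 by rewrite ge_min lexx orbT.
have /andP[h1 h2] := nceil_itv n (ltW r0).
have n0 : 0 <= n%:R :> R by [].
have h3 : c * n%:R <= rho * n%:R by rewrite ler_wpM2r.
have h4 : c * n%:R <= (1 - rho) / 2 * n%:R by rewrite ler_wpM2r.
have h5 : c * n%:R <= (nceil n rho)%:R by rewrite mulrC in h1; exact: le_trans h1.
have h6 : c * n%:R <= n%:R - (nceil n rho)%:R by lra.
split => //; rewrite -(ltr_nat R); first by lra.
by rewrite -natr1; lra.
Qed.

Lemma two_sample_rate_le (R : realFieldType) (x u v : R) : 0 < x -> x <= u -> x <= v ->
  u^-1 + v^-1 <= 2 / x.
Proof.
move=> x0 xu xv; rewrite mulr_natl mulr2n; apply: lerD; rewrite lef_pV2 ?posrE//.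
  exact: lt_le_trans xu.
exact: lt_le_trans xv.
Qed.

Lemma scan_weight_ge (R : realFieldType) (c n u v : R) : 0 < c -> 0 < n ->
  c * n <= u -> c * n <= v -> c ^+ 2 * n <= u * v / n.
Proof.
move=> c0 n0 hu hv; rewrite ler_pdivlMr//.
have -> : c ^+ 2 * n * n = (c * n) * (c * n) by ring.
by apply: ler_pM => //; rewrite mulr_ge0// ltW.
Qed.

Section asymptotic_power.
Context (R : realType) (dX : measure_display) (X : measurableType dX).
Context (d : X -> X -> R).
Hypothesis hd : negative_type_semimetric d.
Context (rho0 rhos rho1 : R).
Hypothesis hrho : [/\ 0 < rho0, rho0 < rhos, rhos < rho1 & rho1 < 1].
Context (F0 : probability X R) (F1 : nat -> probability X R).
Context (dO : nat -> measure_display) (Omega : forall n, measurableType (dO n)).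
Context (P : forall n, probability (Omega n) R).
Context (y : forall n, 'I_n -> {RV (P n) >-> X}).
Arguments y : clear implicits.
Hypothesis hHA : forall n, change_point_model (nceil n rhos) (y n) F0 (F1 n).
Context (y0 : X).
Hypothesis hk : base_kernel_integrable d F0 y0.
Context (lambda : nat -> R) (psi : nat -> X -> R).
Hypothesis hpsi : eigen_expansion (centered_kernel d F0 y0) F0 lambda psi.
Context (M : R).
Hypothesis hM : 0 < M.
Hypothesis hbound : forall (n : nat) (i : 'I_n),
  {ae P n, forall w, centered_kernel d F0 y0 (y n i w) (y n i w) <= M ^+ 2}.

Let k := centered_kernel d F0 y0.
Let phi l x := feature lambda psi x l.

Let phiE x x' :
  (fun N => \sum_(0 <= l < N) phi l x * phi l x') @ \oo --> k x x'.
Proof.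
suff -> : (fun N => \sum_(0 <= l < N) phi l x * phi l x') =
  (fun N => \sum_(0 <= l < N) lambda l * psi l x * psi l x').
  exact: (kernel_expansion hpsi).
apply/funext => N; apply: eq_bigr => l _; rewrite /phi /feature.
rewrite mulrACA -expr2 sqr_sqrtr ?mulrA//; exact: (eigenvalue_ge0 hpsi).
Qed.

Let mphi l : measurable_fun [set: X] (phi l).
Proof.
apply: measurable_funM; first exact: measurable_cst.
exact: (eigenfunction_measurable hpsi).
Qed.

Let dk x x' : d x x' = k x x + k x' x' - 2 * k x x'.
Proof. exact: semimetric_kernel. Qed.

Let rhos_gt0 : 0 < rhos.
Proof. by case: hrho => h1 h2 _ _; exact: lt_trans h2. Qed.

Let rhos_lt1 : rhos < 1.
Proof. by case: hrho => _ _ h1 h2; exact: lt_trans h2. Qed.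

Let tau_ge n : (nceil n rho0 <= nceil n rhos)%N.
Proof. by case: hrho => h1 h2 _ _; apply: le_nceil; exact: ltW. Qed.

Let tau_le n : (nceil n rhos <= nceil n rho1)%N.
Proof. by case: hrho => h1 h2 h3 _; apply: le_nceil; apply: ltW. Qed.

Let indep n : forall i j : 'I_n, i != j -> forall A B,
  measurable A -> measurable B ->
  P n (y n i @^-1` A `&` y n j @^-1` B) =
  (P n (y n i @^-1` A) * P n (y n j @^-1` B))%E.
Proof. by case: (hHA n) => h _ _ _; exact: mutually_independent_pair. Qed.

Let law0 n : forall (i : 'I_n) A, (i < nceil n rhos)%N -> measurable A ->
  distribution (P n) (y n i) A = F0 A.
Proof. by case: (hHA n). Qed.

Let law1 n : forall (i : 'I_n) A, (nceil n rhos <= i)%N -> measurable A ->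
  distribution (P n) (y n i) A = F1 n A.
Proof. by case: (hHA n). Qed.

Lemma S1_consistent (q : R) :
  (((Num.sqrt n%:R)%:E *
      hilbert_norm (fun l => (feature_mean lambda psi F0 l
                              - feature_mean lambda psi (F1 n) l)%R))%E
     @[n --> \oo] --> +oo%E) ->
  P n [set w | q < S1 d (fun i => y n i w) rho0 rho1] @[n --> \oo] --> 1%E.
Proof.
move=> hinf; have [c c0 hc] := change_point_interior rhos_gt0 rhos_lt1.
have mE n : measurable [set w | q < S1 d (fun i => y n i w) rho0 rho1].
  by apply: measurable_set_gt; exact: measurable_S1.
apply: probability_cvg1 => [n|eps e0]; first exact: probability_le1.
have M20 : 0 < M ^+ 2 by rewrite exprn_gt0.
pose A := 8 * M ^+ 2 / (c * eps) + 4 * (`|q| + 4 * M ^+ 2 + 1) / c ^+ 2.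
have A1 : 0 < 8 * M ^+ 2 / (c * eps) by rewrite divr_gt0 ?mulr_gt0.
have A2 : 0 < 4 * (`|q| + 4 * M ^+ 2 + 1) / c ^+ 2.
  rewrite divr_gt0 ?exprn_gt0// mulr_gt0//.
  by have := normr_ge0 q; lra.
have A0 : 0 < A by rewrite addr_gt0.
move/cvgeyPge/(_ (A + 1)) : hinf => hinf.
near=> n.
have cn : 4 <= c * n%:R.
  rewrite -ler_pdivrMl//; near: n; exact: nbhs_infty_ger.
have [t1 tn ct cs] := hc n cn.
have n0 : 0 < n%:R :> R by rewrite -(pmulr_rgt0 _ c0); lra.
have [N hN] : exists N, A <= n%:R * \sum_(0 <= l < N)
    (feature_mean lambda psi F0 l - feature_mean lambda psi (F1 n) l) ^+ 2.
  by apply: hilbert_norm_partial; [exact: ltW|near: n].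
set D := \sum_(0 <= l < N) _ in hN.
have nD0 : 0 < n%:R * D by exact: lt_le_trans hN.
have D0 : 0 < D by rewrite -(pmulr_rgt0 _ n0).
set t := nceil n rhos in t1 tn ct cs.
have cn0 : 0 < c * n%:R by rewrite mulr_gt0.
have w0 : c ^+ 2 * n%:R <= t%:R * (n%:R - t%:R) / n%:R by exact: scan_weight_ge.
have qlt : q < t%:R * (n%:R - t%:R) / n%:R * (D / 4) - 4 * M ^+ 2.
  have : c ^+ 2 * (n%:R * D) <= t%:R * (n%:R - t%:R) / n%:R * D.
    by rewrite mulrA ler_pM2r.
  have : `|q| + 4 * M ^+ 2 + 1 <= c ^+ 2 * (n%:R * D) / 4.
    have : 4 * (`|q| + 4 * M ^+ 2 + 1) / c ^+ 2 <= n%:R * D.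
      by apply: le_trans hN; rewrite lerDr ltW.
    rewrite ler_pdivrMr ?exprn_gt0// [_ * c ^+ 2]mulrC; lra.
  have := ler_norm q; lra.
apply: le_trans (T1_power dk mphi phiE (@indep n) (@law0 n) (@law1 n)
  (@hbound n) t1 tn (N := N) (erefl _) D0 qlt (mE n) _).
  rewrite lee_fin lerD2l lerN2 -/D.
  have h := two_sample_rate_le cn0 ct cs.
  apply: (@le_trans _ _ (2 / (c * n%:R) * (4 * M ^+ 2) / D)).
    by rewrite ler_pM2r ?invr_gt0// ler_pM2r//; lra.
  have -> : 2 / (c * n%:R) * (4 * M ^+ 2) / D = 8 * M ^+ 2 / c / (n%:R * D).
    by field; rewrite !gt_eqF.
  have : 8 * M ^+ 2 / (c * eps) <= n%:R * D.
    by apply: le_trans hN; rewrite lerDl ltW.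
  have -> : 8 * M ^+ 2 / (c * eps) = 8 * M ^+ 2 / c / eps.
    by field; rewrite !gt_eqF.
  by move=> h8; rewrite ler_pdivrMr// [leRHS]mulrC -ler_pdivrMr//.
move=> w /= /lt_le_trans; apply.
exact: (@scan_max_ge _ n t rho0 rho1
  (fun t => t%:R * (n%:R - t%:R) / n%:R * T1 d (fun i => y n i w) t)
  (tau_ge n) (tau_le n)).
Unshelve. all: by end_near. Qed.

Let variance_trunc (F : probability X R) :
  {ae F, forall x, k x x <= M ^+ 2} ->
  (forall l, feature_mean lambda psi F l = 0) ->
  feature_variance lambda psi F = (\int[F]_x trunc_kernel k M x x)%:E.
Proof.
move=> gF m0; rewrite -(kernel_diag_trunc mphi phiE gF).
apply: eq_integral => x _; rewrite hilbert_norm_sqr.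
apply/cvg_lim => //.
rewrite (_ : (fun N => _) = EFin \o (fun N => \sum_(0 <= l < N) phi l x * phi l x)).
  by apply: cvg_EFin; [exact: nearW|exact: phiE].
apply/funext => N /=; rewrite -sumEFin; apply: eq_bigr => l _.
by rewrite m0 subr0 expr2.
Qed.

Lemma S2_consistent (q : R) :
  (forall n, feature_mean lambda psi F0 =1 feature_mean lambda psi (F1 n)) ->
  ((Num.sqrt n%:R)%:E *
      `|feature_variance lambda psi F0 - feature_variance lambda psi (F1 n)|)%E
     @[n --> \oo] --> +oo%E ->
  P n [set w | q < S2 d (fun i => y n i w) rho0 rho1] @[n --> \oo] --> 1%E.
Proof.
move=> hmean hinf; have [c c0 hc] := change_point_interior rhos_gt0 rhos_lt1.
have mE n : measurable [set w | q < S2 d (fun i => y n i w) rho0 rho1].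
  by apply: measurable_set_gt; exact: measurable_S2.
apply: probability_cvg1 => [n|eps e0]; first exact: probability_le1.
have M20 : 0 < M ^+ 2 by rewrite exprn_gt0.
have M40 : 0 < M ^+ 4 by rewrite exprn_gt0.
pose L := 4 * M ^+ 2 / eps.
have L0 : 0 < L by rewrite divr_gt0// mulr_gt0.
pose B := 25 * (M ^+ 2 + L) / c + 16 * M ^+ 4 / (c * eps) +
  16 * M ^+ 2 * (`|q| + 1) / c + 1.
have B1 : 0 < 25 * (M ^+ 2 + L) / c by rewrite divr_gt0// mulr_gt0// addr_gt0.
have B2 : 0 < 16 * M ^+ 4 / (c * eps) by rewrite divr_gt0 ?mulr_gt0.
have B3 : 0 < 16 * M ^+ 2 * (`|q| + 1) / c.
  by rewrite divr_gt0// mulr_gt0 ?mulr_gt0//; have := normr_ge0 q; lra.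
move/cvgeyPge/(_ B) : hinf => hinf.
near=> n.
have cn : 4 <= c * n%:R.
  rewrite -ler_pdivrMl//; near: n; exact: nbhs_infty_ger.
have n1 : 1 <= n%:R :> R by near: n; exact: nbhs_infty_ger.
have [t1 tn ct cs] := hc n cn.
set t := nceil n rhos in t1 tn ct cs.
have n0 : 0 < n%:R :> R by lra.
have good0 := law0_good mphi phiE (@law0 n) (@hbound n) t1 tn.
have good1 := law1_good mphi phiE (@law1 n) (@hbound n) tn.
have z0 l : \int[F0]_x trunc_feature k phi M l x = 0.
  apply: (centered_feature_mean0 mphi phiE good0) => x.
  exact: centered_kernel_mean0.
have m0 l : feature_mean lambda psi F0 l = 0.
  by rewrite -(z0 l) -(feature_mean_trunc mphi phiE good0).
have m1 l : feature_mean lambda psi (F1 n) l = 0 by rewrite -(hmean n l).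
have z1 l : \int[F1 n]_x trunc_feature k phi M l x = 0.
  by rewrite -(m1 l) -(feature_mean_trunc mphi phiE good1).
pose v := \int[F0]_x trunc_kernel k M x x - \int[F1 n]_x trunc_kernel k M x x.
have Bv : B <= Num.sqrt n%:R * `|v|.
  have : (B%:E <= (Num.sqrt n%:R)%:E *
      `|feature_variance lambda psi F0 - feature_variance lambda psi (F1 n)|)%E.
    by near: n.
  by rewrite (variance_trunc good0 m0) (variance_trunc good1 m1) -EFinB.
set r := Num.sqrt n%:R in Bv.
have r1 : 1 <= r by rewrite -sqrtr1 ler_wsqrtr.
have rE : n%:R = r * r by rewrite -expr2 sqr_sqrtr// ltW.
have cr0 : 0 < c * r by rewrite mulr_gt0//; lra.
have B10 : 1 <= B by rewrite lerDr; lra.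
have cn0 : 0 < c * n%:R by rewrite mulr_gt0.
pose m := c * n%:R / 2.
have vlarge : 12 * (M ^+ 2 + L) < `|v| * m.
  have h : 25 * (M ^+ 2 + L) <= c * B.
    have : 25 * (M ^+ 2 + L) / c <= B by rewrite /B; lra.
    by rewrite ler_pdivrMr// [leRHS]mulrC.
  have h' : c * B <= c * (r * `|v|) by rewrite ler_pM2l.
  have h'' : c * (r * `|v|) <= r * (c * (r * `|v|)).
    by rewrite ler_peMl// mulr_ge0 ?(ltW c0)// mulr_ge0// (le_trans _ r1).
  have -> : `|v| * m = r * (c * (r * `|v|)) / 2 by rewrite /m rE; ring.
  have : 0 < M ^+ 2 + L by rewrite addr_gt0.
  lra.
have w0 : c ^+ 2 * n%:R <= t%:R * (n%:R - t%:R) / n%:R by exact: scan_weight_ge.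
have sw : c * r <= Num.sqrt (t%:R * (n%:R - t%:R) / n%:R).
  rewrite -(ger0_norm (ltW cr0)) -sqrtr_sqr ler_wsqrtr//.
  by apply: le_trans w0; rewrite exprMn /r sqr_sqrtr// ltW.
have qlt : q < (8 * M ^+ 2)^-1 * Num.sqrt (t%:R * (n%:R - t%:R) / n%:R) * (`|v| / 2).
  have h1 : c * (r * `|v|) <= Num.sqrt (t%:R * (n%:R - t%:R) / n%:R) * `|v|.
    by rewrite mulrA ler_wpM2r.
  have h2 : 16 * M ^+ 2 * (`|q| + 1) <= c * (r * `|v|).
    have : 16 * M ^+ 2 * (`|q| + 1) / c <= r * `|v|.
      by apply: le_trans Bv; rewrite /B; lra.
    by rewrite ler_pdivrMr// [_ * c]mulrC.
  have -> : (8 * M ^+ 2)^-1 * Num.sqrt (t%:R * (n%:R - t%:R) / n%:R) * (`|v| / 2) =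
      Num.sqrt (t%:R * (n%:R - t%:R) / n%:R) * `|v| / (16 * M ^+ 2).
    by field; rewrite gt_eqF.
  apply: (@lt_le_trans _ _ (`|q| + 1)); first by have := ler_norm q; lra.
  rewrite ler_pdivlMr ?mulr_gt0// [leLHS]mulrC.
  exact: le_trans h1.
have mcn : m <= c * n%:R - 1 by rewrite /m; lra.
have mp : 0 < m by rewrite divr_gt0.
have mt : m <= t%:R - 1 by lra.
have ms : m <= n%:R - t%:R - 1 by lra.
apply: le_trans (T2_power dk mphi phiE (@indep n) (@law0 n) (@law1 n)
  (@hbound n) t1 tn z0 z1 (erefl _) mp mt ms L0 hM vlarge qlt (mE n) _).
  rewrite lee_fin lerD2l lerN2 -/v.
  have h := two_sample_rate_le cn0 ct cs.
  have rv0 : 0 < r * `|v| by apply: lt_le_trans Bv; lra.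
  have v0 : 0 < `|v| by move: rv0; rewrite pmulr_rgt0//; lra.
  have vn0 : v != 0 by rewrite -normr_gt0.
  have v20 : 0 < v ^+ 2 by rewrite -[ltRHS]real_normK ?num_real// exprn_gt0.
  have -> : 2 * M ^+ 2 / L = eps / 2.
    by rewrite /L; field; rewrite !gt_eqF.
  suff : (t%:R^-1 + (n%:R - t%:R)^-1) * (4 * M ^+ 4) / v ^+ 2 <= eps / 2 by lra.
  apply: (@le_trans _ _ (2 / (c * n%:R) * (4 * M ^+ 4) / v ^+ 2)).
    by rewrite ler_pM2r ?invr_gt0// ler_pM2r//; lra.
  have -> : 2 / (c * n%:R) * (4 * M ^+ 4) / v ^+ 2 =
      8 * M ^+ 4 / c / (r * `|v|) ^+ 2.
    rewrite exprMn real_normK ?num_real// sqr_sqrtr ?(ltW n0)//.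
    by field; rewrite vn0 !gt_eqF.
  rewrite ler_pdivrMr ?exprn_gt0//.
  have h1 : 16 * M ^+ 4 / (c * eps) <= r * `|v|.
    by apply: le_trans Bv; rewrite /B; lra.
  have h2 : 16 * M ^+ 4 / c <= eps * (r * `|v|).
    move: h1; have -> : 16 * M ^+ 4 / (c * eps) = 16 * M ^+ 4 / c / eps.
      by field; rewrite !gt_eqF.
    by rewrite ler_pdivrMr// [leRHS]mulrC.
  have h3 : r * `|v| <= (r * `|v|) ^+ 2.
    by rewrite expr2 ler_peMl ?(ltW rv0)//; exact: le_trans Bv.
  have h4 : eps * (r * `|v|) <= eps * (r * `|v|) ^+ 2 by rewrite ler_pM2l.
  have -> : 8 * M ^+ 4 / c = 16 * M ^+ 4 / c / 2 by field; rewrite gt_eqF.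
  by rewrite [leRHS]mulrAC ler_pM2r//; apply: le_trans h4.
move=> w /= /lt_le_trans; apply.
exact: (@scan_max_ge _ n t rho0 rho1 (fun t => (2 * shat d (fun i => y n i w))^-1 *
  Num.sqrt (t%:R * (n%:R - t%:R) / n%:R) * T2 d (fun i => y n i w) t)
  (tau_ge n) (tau_le n)).
Unshelve. all: by end_near. Qed.

End asymptotic_power.

Theorem theorem4p2 (R : realType) (dX : measure_display)
    (X : measurableType dX) (d : X -> X -> R)
    (hd : negative_type_semimetric d)
    (rho0 rhos rho1 alpha : R)
    (hrho : [/\ 0 < rho0, rho0 < rhos, rhos < rho1 & rho1 < 1])
    (halpha : 0 < alpha < 1)
    (F0 : probability X R) (F1 : nat -> probability X R)
    (dO : nat -> measure_display) (Omega : forall n, measurableType (dO n))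
    (P : forall n, probability (Omega n) R)
    (y : forall n, 'I_n -> {RV (P n) >-> X})
    (hHA : forall n, change_point_model (nceil n rhos) (y n) F0 (F1 n))
    (y0 : X) (hk : base_kernel_integrable d F0 y0)
    (lambda : nat -> R) (psi : nat -> X -> R)
    (hpsi : eigen_expansion (centered_kernel d F0 y0) F0 lambda psi)
    (M : R) (hM : 0 < M)
    (hbound : forall (n : nat) (i : 'I_n),
       {ae P n, forall w,
          centered_kernel d F0 y0 (y n i w) (y n i w) <= M ^+ 2}) :
  (((Num.sqrt n%:R)%:E *
      hilbert_norm (fun l => (feature_mean lambda psi F0 l
                              - feature_mean lambda psi (F1 n) l)%R))%E
     @[n --> \oo] --> +oo%E ->
   forall Q1 : probability R R, null_limit_law1 lambda rho0 rho1 Q1 ->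
     P n [set w | upper_quantile Q1 alpha
                  < S1 d (fun i => y n i w) rho0 rho1]
       @[n --> \oo] --> 1%E)
  /\
  ((forall n, feature_mean lambda psi F0 =1 feature_mean lambda psi (F1 n)) ->
   ((Num.sqrt n%:R)%:E *
      `|feature_variance lambda psi F0 - feature_variance lambda psi (F1 n)|)%E
     @[n --> \oo] --> +oo%E ->
   forall Q2 : probability R R, null_limit_law2 rho0 rho1 Q2 ->
     P n [set w | upper_quantile Q2 alpha
                  < S2 d (fun i => y n i w) rho0 rho1]
       @[n --> \oo] --> 1%E).

Proof.
split=> [hinf Q1 _|hmean hinf Q2 _].
  exact: (S1_consistent hd hrho hHA hpsi hM hbound).
exact: (S2_consistent hd hrho hHA hk hpsi hM hbound).
Qed.
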